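(* Let $r\ge 2$, $P=\mathbb{C}[X_0,\dots,X_r]$, and let $I=(f_0,\dots,f_r)\subset P$ be a proper ideal generated by $r+1$ homogeneous polynomials with $\deg(f_j)=d_j$. Put $R=P/I$, $Y=\mathrm{Proj}(R)$ and $\sigma=\sum_{j=0}^r d_j-r-1$. Assume that $\dim(Y)\le 0$ (the case $Y=\emptyset$ is allowed). Then there is a natural isomorphism of graded $P$-modules $$H^0_{\mathbf{m}}(R)\cong [H^0_{\mathbf{m}}(R)(\sigma)]^\vee .$$ Therefore there are natural isomorphisms $$H^0_{\mathbf{m}}(R)_k\cong H^0_{\mathbf{m}}(R)_{\sigma-k}^\vee,\qquad 0\le k\le\sigma .$$
   Context: $\mathbf{m}=(X_0,\dots,X_r)$ is the irrelevant maximal ideal of $P$. $H^0_{\mathbf{m}}(R)$ is the $0$-th local cohomology module of $R$ with respect to $\mathbf{m}$, i.e. $H^0_{\mathbf{m}}(R)=I^{sat}/I$ where $I^{sat}$ is the saturation of $I$ with respect to $\mathbf{m}$; equivalently $H^0_{\mathbf{m}}(R)=\bigoplus_{k\in\mathbb{Z}}H^1(\mathbb{P}^r,\mathcal{K}(k))$, where $\mathcal{K}$ is the kernel of the sheaf map $\bigoplus_{j}\mathcal{O}_{\mathbb{P}^r}(-d_j)\to \mathcal{O}_{\mathbb{P}^r}$ given by $(f_0,\dots,f_r)$. It is a graded $P$-module of finite length. For a graded $P$-module $M=\bigoplus_k M_k$ with finite-dimensional graded pieces, $M(\sigma)_k=M_{\sigma+k}$, and $M^\vee$ is the graded dual with $(M^\vee)_k=\mathrm{Hom}_{\mathbb{C}}(M_{-k},\mathbb{C})$;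 for a vector space $V$, $V^\vee=\mathrm{Hom}_{\mathbb{C}}(V,\mathbb{C})$. *)

(* Defs.v *)
From HB Require Import structures.
From mathcomp Require Import all_boot all_order all_algebra.
From mathcomp Require Import boolp classical_sets functions reals.
From mathcomp.real_closed Require Import complex.
From mathcomp.multinomials Require Import mpoly.

Set Implicit Arguments.
Unset Strict Implicit.
Unset Printing Implicit Defensive.

Import Order.TTheory GRing.Theory Num.Theory.

Local Open Scope classical_set_scope.
Local Open Scope ring_scope.
Local Open Scope quotient_scope.

(** * Ideals of a commutative ring, as sets *)

Section Ideals.
Variable S : comNzRingType.
Implicit Types (G J L : set S).

Definition is_ideal J : Prop :=
  [/\ J 0, forall x y, J x -> J y -> J (x + y) & forall a x, J x -> J (a * x)].

Definition ideal_gen G : set S := smallest is_ideal G.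

Definition ideal_prod J L : set S :=
  ideal_gen [set z | exists x y, [/\ J x, L y & z = x * y]].

Definition ideal_pow J (N : nat) : set S := iter N (ideal_prod J) setT.

(* The union over N of the colon ideals (J : L^N). *)
Definition saturation J L : set S :=
  [set x | exists N : nat, forall a, ideal_pow L N a -> J (a * x)].

Lemma ideal_gen_ideal G : is_ideal (ideal_gen G).
Proof.
split=> [J [[J0 _ _] _] //|x y hx hy J [iJ GJ]|a x hx J [iJ GJ]].
  by case: (iJ) => _ h _; apply: h; [apply: hx | apply: hy].
by case: (iJ) => _ _ h; apply: h; apply: hx.
Qed.

Lemma ideal_pow_ideal J N : is_ideal (ideal_pow J N).
Proof. by case: N => [|N]; [split | apply: ideal_gen_ideal]. Qed.

Lemma ideal_pow_le J N N' : (N <= N')%N -> ideal_pow J N' `<=` ideal_pow J N.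
Proof.
move=> /subnKC <-; elim: (N' - N)%N => [|k IH]; first by rewrite addn0.
rewrite addnS; apply: subset_trans IH; apply: smallest_sub.
  exact: ideal_pow_ideal.
move=> _ [x [y [_ hy ->]]].
by case: (ideal_pow_ideal J (N + k)) => _ _; apply.
Qed.

Definition is_prime_ideal J : Prop :=
  [/\ is_ideal J, ~ J 1 & forall x y, J (x * y) -> J x \/ J y].

(** * Proj and its dimension *)

(* The grading of [S] is given by the family [gr] of its homogeneous pieces,
   and [irr] is the ideal of the elements with no component in degree 0. *)
Variables (gr : nat -> set S) (irr : set S).

Definition is_homogeneous_ideal J : Prop :=
  is_ideal J /\
  forall x, J x -> exists s : seq S,
    (forall y, y \in s -> J y /\ exists k, gr k y) /\ x = \sum_(y <- s) y.

Definition proj_point J : Prop :=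
  [/\ is_prime_ideal J, is_homogeneous_ideal J & ~ (irr `<=` J)].

Definition proj_closed (Z : set (set S)) : Prop :=
  exists2 J, is_homogeneous_ideal J &
    Z = [set p | proj_point p /\ J `<=` p].

Definition proj_irreducible (Z : set (set S)) : Prop :=
  Z !=set0 /\
  forall Z1 Z2, proj_closed Z1 -> proj_closed Z2 ->
    Z `<=` Z1 `|` Z2 -> Z `<=` Z1 \/ Z `<=` Z2.

(* Krull dimension of the underlying space: every strict chain
   Z_0 < ... < Z_k of irreducible closed subsets has k <= n.  It holds for
   the empty space. *)
Definition proj_dim_le (n : nat) : Prop :=
  forall (k : nat) (Z : nat -> set (set S)),
    (forall i, (i <= k)%N -> proj_closed (Z i) /\ proj_irreducible (Z i)) ->
    (forall i, (i < k)%N -> Z i `<` Z i.+1) -> (k <= n)%N.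

End Ideals.

(** * The linear dual of a vector space *)

Section Dual.
Variables (K : fieldType) (V : lmodType K).

Definition linear_pred : {pred V -> K^o} := fun phi => `[< linear phi >].

Lemma linear_pred_submod : submod_closed linear_pred.
Proof.
split=> [|a phi psi /asboolP lphi /asboolP lpsi]; apply/asboolP => c x y.
  by rewrite scaler0 addr0.
rewrite -![(a *: phi + psi) _]/(a *: phi _ + psi _) lphi lpsi !scalerDr.
by rewrite !scalerA mulrC addrACA.
Qed.

HB.instance Definition _ :=
  GRing.isSubmodClosed.Build K (V -> K^o) linear_pred linear_pred_submod.

Record dual := Dual { dual_fun :> V -> K^o; _ : dual_fun \in linear_pred }.

HB.instance Definition _ := [isSub for dual_fun].
HB.instance Definition _ := [Choice of dual by <:].
HB.instance Definition _ := [SubChoice_isSubLmodule of dual by <:].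

Lemma dual_linear (phi : dual) : linear phi.
Proof. by case: phi => phi /= /asboolP. Qed.

End Dual.

(** * Graded modules over a polynomial ring *)

Section GradedModules.
Variables (K : fieldType) (n : nat).
Local Notation P := {mpoly K[n]}.

(* The homogeneous pieces of P in integral degrees. *)
Definition zhomog (e : int) (p : P) : bool :=
  if e is Posz d then p \is d.-homog else p == 0.

Definition zcomp (e : int) (p : P) : P :=
  if e is Posz d then pihomog mdeg d p else 0.

Lemma zcompP e p : zhomog e (zcomp e p).
Proof. by case: e => [d|d] /=; rewrite ?pihomogP. Qed.

Lemma zcomp_linear e : linear (zcomp e).
Proof.
case: e => [d|d] c p q /=; first by rewrite linearP.
by rewrite scaler0 addr0.
Qed.

Lemma zcomp_id e p : zhomog e p -> zcomp e p = p.
Proof. by case: e => [d /pihomog_dE|d /eqP ->]. Qed.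

Lemma zcomp_neq e e' p : zhomog e p -> e' != e -> zcomp e' p = 0.
Proof.
case: e => [d|d] hp; case: e' => [d'|d'] //= ne.
  by rewrite eq_sym eqz_nat in ne; rewrite (pihomog_ne0 ne hp).
by rewrite (eqP hp) linear0.
Qed.

Lemma zhomog0 e : zhomog e 0.
Proof. by case: e => [d|d] /=; rewrite ?eqxx ?dhomog0. Qed.

Lemma zhomogM e e' p q : zhomog e p -> zhomog e' q -> zhomog (e + e') (p * q).
Proof.
case: e => [d|d] hp; case: e' => [d'|d'] hq; first exact: dhomogM.
- by rewrite (eqP hq) mulr0 zhomog0.
- by rewrite (eqP hp) mul0r zhomog0.
- by rewrite (eqP hp) mul0r zhomog0.
Qed.

Lemma zcomp0 e : zcomp e 0 = 0.
Proof. by case: e => [d|d] //=; rewrite linear0. Qed.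

Lemma zhomog_lin e c p q :
  zhomog e p -> zhomog e q -> zhomog e (c *: p + q).
Proof.
case: e => [d|d] /=; first by move=> hp hq; rewrite rpredD ?rpredZ.
by move=> /eqP -> /eqP ->; rewrite scaler0 addr0.
Qed.

(* [gact k l p x] is the component in degree [l] of [p * x], for [x] of degree
   [k]; so it depends on [p] only through its component of degree [l - k]. *)
Record grModule := GrModule {
  gpiece :> int -> lmodType K;
  gact : forall k l : int, P -> gpiece k -> gpiece l;
  gact_linear : forall k l p, linear (@gact k l p);
  gact_linearl : forall k l x, linear (fun p => @gact k l p x);
  gact1 : forall k x, @gact k k 1 x = x;
  gact_deg : forall e k l p x, zhomog e p -> e != l - k -> @gact k l p x = 0;
  gactM : forall k j l p q x,
    zhomog (j - k) p -> zhomog (l - j) q ->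
    @gact j l q (@gact k j p x) = @gact k l (q * p) x
}.
Arguments gact : clear implicits.

Local Obligation Tactic := idtac.

(* M(s)_k = M_(s + k) *)
Program Definition gr_shift (s : int) (M : grModule) : grModule :=
  @GrModule (fun k => M (s + k)) (fun k l => gact M (s + k) (s + l))
    _ _ _ _ _.
Next Obligation. by move=> s M k l; exact: gact_linear. Qed.
Next Obligation. by move=> s M k l; exact: gact_linearl. Qed.
Next Obligation. by move=> s M k; exact: gact1. Qed.
Next Obligation.
move=> s M e k l p x hp ne; apply: gact_deg hp _.
by rewrite opprD addrACA subrr add0r.
Qed.
Next Obligation.
move=> s M k j l p q x hp hq.
by apply: gactM; rewrite opprD addrACA subrr add0r.
Qed.

Lemma dual_comp_subproof (V W : lmodType K) (g : V -> W) (glin : linear g)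
  (phi : dual W) : (fun v => phi (g v)) \in @linear_pred K V.
Proof. by apply/asboolP => c x y; rewrite glin dual_linear. Qed.

Definition dual_comp (V W : lmodType K) (g : V -> W) (glin : linear g)
  (phi : dual W) : dual V := Dual (dual_comp_subproof glin phi).

Lemma dualP (V : lmodType K) (phi psi : dual V) :
  (forall v, phi v = psi v) -> phi = psi.
Proof. by move=> h; apply/val_inj/funext. Qed.

(* (M^vee)_k = Hom(M_(-k), K), with (p * phi)(x) = phi(p * x) *)
Program Definition gr_dual (M : grModule) : grModule :=
  @GrModule (fun k => dual (M (- k)))
    (fun k l p phi => dual_comp (@gact_linear M (- l) (- k) p) phi)
    _ _ _ _ _.
Next Obligation. by move=> M k l p c phi psi; apply: dualP. Qed.
Next Obligation.
move=> M k l phi c p q; apply: dualP => v /=.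
by rewrite gact_linearl dual_linear.
Qed.
Next Obligation. by move=> M k phi; apply: dualP => v /=; rewrite gact1. Qed.
Next Obligation.
move=> M e k l p phi hp ne; apply: dualP => v /=.
rewrite (gact_deg v hp); last by rewrite opprK addrC.
have := dual_linear phi (-1) 0 0.
by rewrite scaler0 addr0 scaleN1r addNr.
Qed.
Next Obligation.
move=> M k j l p q phi hp hq; apply: dualP => v /=.
by rewrite mulrC gactM // opprK addrC.
Qed.

Definition is_linear_iso (V W : lmodType K) (g : V -> W) : Prop :=
  linear g /\ bijective g.

Definition is_gr_iso (M N : grModule) (Phi : forall k, M k -> N k) : Prop :=
  (forall k, is_linear_iso (Phi k)) /\
  forall k l p x, Phi l (gact M k l p x) = gact N k l p (Phi k x).

End GradedModules.

(** * The quotient R = P/I and its local cohomology *)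

Section LocalCohomology.
Variables (K : fieldType) (n : nat).
Local Notation P := {mpoly K[n]}.

(* The irrelevant maximal ideal. *)
Definition mirr : set P := ideal_gen (range (fun i : 'I_n => 'X_i : P)).

Section Quotient.
(* [idealr] is the library's structure of proper ideals; membership in it is
   boolean, which is no restriction classically. *)
Variable I : idealr P.

Definition quo := {ideal_quot I}.
HB.instance Definition _ := GRing.ComNzRing.on quo.

Definition quo_pi (p : P) : quo := \pi_{ideal_quot I} p.

Lemma quo_pi_zmod : zmod_morphism quo_pi.
Proof. exact: (rmorphB (\pi_{ideal_quot I} : {rmorphism P -> _})). Qed.

Lemma quo_pi_monoid : monoid_morphism quo_pi.
Proof.
split; first exact: (rmorph1 (\pi_{ideal_quot I} : {rmorphism P -> _})).
exact: (rmorphM (\pi_{ideal_quot I} : {rmorphism P -> _})).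
Qed.

HB.instance Definition _ := GRing.isZmodMorphism.Build P quo quo_pi quo_pi_zmod.
HB.instance Definition _ :=
  GRing.isMonoidMorphism.Build P quo quo_pi quo_pi_monoid.

Definition quo_scale (c : K) (x : quo) : quo := quo_pi c%:MP * x.

Fact quo_scaleA a b x : quo_scale a (quo_scale b x) = quo_scale (a * b) x.
Proof. by rewrite /quo_scale mulrA -rmorphM -mpolyCM. Qed.
Fact quo_scale1 : left_id 1 quo_scale.
Proof. by move=> x; rewrite /quo_scale rmorph1 mul1r. Qed.
Fact quo_scaleDr : right_distributive quo_scale +%R.
Proof. by move=> c x y; rewrite /quo_scale mulrDr. Qed.
Fact quo_scaleDl x : {morph quo_scale^~ x : a b / a + b}.
Proof. by move=> a b; rewrite /quo_scale mpolyCD rmorphD mulrDl. Qed.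

HB.instance Definition _ := GRing.Zmodule_isLmodule.Build K quo
  quo_scaleA quo_scale1 quo_scaleDr quo_scaleDl.

(* The homogeneous pieces and the irrelevant ideal of the graded ring R. *)
Definition quo_gr (k : nat) : set quo :=
  [set quo_pi p | p in [set p : P | p \is k.-homog]].
Definition quo_irr : set quo := quo_pi @` mirr.

(* dim Proj(R) <= e *)
Definition dim_Proj_le (e : nat) : Prop := proj_dim_le quo_gr quo_irr e.

(* I^sat *)
Definition Isat : set P := saturation [set p : P | p \in I] mirr.

(* H^0_m(R)_k = (I^sat / I)_k, as a subspace of R. *)
Definition H0m_pred (k : int) : {pred quo} :=
  fun x => `[< exists p : P, [/\ zhomog k p, Isat p & x = quo_pi p] >].

Lemma IsatD p q : Isat p -> Isat q -> Isat (p + q).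
Proof.
move=> [N hN] [N' hN']; exists (maxn N N') => a ha /=; rewrite mulrDr rpredD //.
  by apply: hN; apply: ideal_pow_le ha; exact: leq_maxl.
by apply: hN'; apply: ideal_pow_le ha; exact: leq_maxr.
Qed.

Lemma Isat0 : Isat 0.
Proof. by exists 0%N => a _ /=; rewrite mulr0 rpred0. Qed.

Lemma IsatM a p : Isat p -> Isat (a * p).
Proof.
move=> [N hN]; exists N => b hb /=; rewrite mulrCA; exact: (idealMr _ (hN b hb)).
Qed.

Lemma H0m_submod k : submod_closed (H0m_pred k).
Proof.
split=> [|c _ _ /asboolP [p [hp sp ->]] /asboolP [q [hq sq ->]]]; apply/asboolP.
  by exists 0; rewrite zhomog0 rmorph0; split=> //; exact: Isat0.
exists (c *: p + q); split; first exact: zhomog_lin.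
  by apply: IsatD => //; rewrite -mul_mpolyC; apply: IsatM.
by rewrite rmorphD -mul_mpolyC rmorphM.
Qed.

HB.instance Definition _ (k : int) :=
  GRing.isSubmodClosed.Build K quo (H0m_pred k) (H0m_submod k).

Record H0m_piece (k : int) :=
  H0mPiece { H0m_val :> quo; _ : H0m_val \in H0m_pred k }.

HB.instance Definition _ k := [isSub for @H0m_val k].
HB.instance Definition _ k := [Choice of H0m_piece k by <:].
HB.instance Definition _ k := [SubChoice_isSubLmodule of H0m_piece k by <:].

Lemma H0m_act_subproof (k l : int) (p : P) (x : H0m_piece k) :
  quo_pi (zcomp (l - k) p) * val x \in H0m_pred l.
Proof.
case: x => _ /= /asboolP [q [hq sq ->]]; apply/asboolP.
exists (zcomp (l - k) p * q); split; last by rewrite rmorphM.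
  by have := zhomogM (zcompP (l - k) p) hq; rewrite subrK.
exact: IsatM.
Qed.

Definition H0m_act (k l : int) (p : P) (x : H0m_piece k) : H0m_piece l :=
  H0mPiece (H0m_act_subproof l p x).

Local Obligation Tactic := idtac.

Program Definition H0m : grModule K n :=
  @GrModule K n H0m_piece H0m_act _ _ _ _ _.
Next Obligation.
move=> k l p c x y; apply: val_inj.
rewrite /= /GRing.scale /= /quo_scale.
by rewrite mulrDr mulrCA.
Qed.
Next Obligation.
move=> k l x c p q; apply: val_inj.
rewrite /= zcomp_linear rmorphD mulrDl -mul_mpolyC rmorphM -mulrA.
by [].
Qed.
Next Obligation.
move=> k x; apply: val_inj.
rewrite /= subrr (@zcomp_id _ _ 0) ?rmorph1 ?mul1r //; exact: dhomog1.
Qed.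
Next Obligation.
move=> e k l p x hp ne; apply: val_inj; rewrite /= (zcomp_neq hp) 1?eq_sym //.
by rewrite rmorph0 mul0r.
Qed.
Next Obligation.
move=> k j l p q x hp hq; apply: val_inj.
rewrite /= !zcomp_id // ?rmorphM ?mulrA //.
by have := zhomogM hq hp; rewrite addrA subrK.
Qed.

End Quotient.
End LocalCohomology.

(** * The data (f_0, ..., f_r), and naturality in them *)

Section Data.
Variables (K : fieldType) (r : nat).
Local Notation P := {mpoly K[r.+1]}.
Implicit Types (I : idealr P) (d : 'I_r.+1 -> nat) (f : 'I_r.+1 -> P).

(* I = (f_0, ..., f_r) with f_j a form of degree d_j, and dim Proj(P/I) <= 0.
   The zero polynomial is a form of every degree. *)
Definition admissible I d f : Prop :=
  [/\ forall j, f j \is (d j).-homog,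
      [set p : P | p \in I] = ideal_gen (range f)
    & dim_Proj_le I 0].

Definition sigma d : int := (\sum_j d j)%N%:Z - r%:Z - 1.

(* The graded automorphism of P given by a linear change of coordinates. *)
Definition linsub (g : 'M[K]_r.+1) (p : P) : P :=
  p \mPo [tuple \sum_j g i j *: 'X_j | i < r.+1].

(* Naturality of a family of maps Phi_f : H -> [H(sigma)]^vee in (f_0,...,f_r).
   An isomorphism from f to f' is a graded automorphism g of P together with
   a graded isomorphism of the free modules \oplus_j P(-d_j), given by an
   invertible matrix A with homogeneous entries, such that f' = A g(f).
   It induces the isomorphism [p] |-> [g p] from H to H'.  The twist sigma
   arises from omega_P = P(-r-1) and det(\oplus_j P(-d_j)) = P(-\sum_j d_j);
   these trivialisations, by dX_0 /\ ... /\ dX_r and by e_0 /\ ... /\ e_r,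
   are multiplied by det g and det A, whence the two determinants. *)
Definition natural_in_data
    (Phi : forall I d f k, H0m I k -> gr_dual (gr_shift (sigma d) (H0m I)) k) :
    Prop :=
  forall I d f I' d' f' (g : 'M[K]_r.+1) (A : 'M[P]_r.+1) (a : K),
    admissible I d f -> admissible I' d' f' ->
    g \in unitmx ->
    (forall j i, zhomog ((d' j)%:Z - (d i)%:Z) (A j i)) ->
    \det A = a%:MP -> a != 0 ->
    (forall j, f' j = \sum_i A j i * linsub g (f i)) ->
    forall (k : int) (p q : P)
      (x : H0m I k) (y : H0m I (sigma d - k))
      (x' : H0m I' k) (y' : H0m I' (sigma d' - k)),
      val x = quo_pi I p -> val x' = quo_pi I' (linsub g p) ->
      val y = quo_pi I q -> val y' = quo_pi I' (linsub g q) ->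
      Phi I d f k x y = a * \det g * Phi I' d' f' k x' y'.

End Data.

(* Main.v *)
From HB Require Import structures.
Require Import Defs.
From mathcomp Require Import all_boot all_order all_algebra.
From mathcomp Require Import boolp classical_sets functions reals.
From mathcomp.real_closed Require Import complex.
From mathcomp.multinomials Require Import mpoly.
From mathcomp Require Import ring.

Import Order.TTheory GRing.Theory Num.Theory.
Local Open Scope ring_scope.

Set Implicit Arguments.
Unset Strict Implicit.
Unset Printing Implicit Defensive.

(** Put [n = r + 1], and write [f_j(X) - f_j(Y) = \sum_i T_ji (X_i - Y_i)] in the
    ring [P \otimes P] of polynomials in two sets of variables.  The isomorphism
    is the inverse of contraction with the Bezoutian [D = \det T].

    By Cramer's rule [(X_i - Y_i) D] is in the ideal of the [f_j(X) - f_j(Y)], so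
    modulo [f(X)] and [f(Y)] multiplication by [X_i] and by [Y_i] agree on [D].
    Hence contracting [D] in one set of variables with a functional [phi] on
    [P / I] that is supported in a single degree gives an element of [P / I] killed
    by a power of the irrelevant ideal, and this contraction is [P]-linear.  Since
    [D] is a form of degree [sigma], functionals of degree [sigma - k] give
    elements of degree [k] of [I^sat / I] ([contraction_saturated]).

    Conversely every [x] in [I^sat] is such a contraction
    ([saturation_is_contraction]).  Dimension at most 0 gives a linear form [l]
    such that [I + (l)] contains powers of all the variables; this uses only
    that [P] is Noetherian (Dickson's lemma) and that a chain of two relevant
    primes over [I] is excluded ([eventually_contains_powers]).  For [M] large,
    [x l^M = \sum_j u_j f_j] and [X_i^N = \sum_j b_ij f_j + b'_i l^M].  The
    determinant of the matrix [b] bordered by [-b'], [u] and [x] is a numerator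
    for the residue of [x] with respect to [f]: multiplying it by [D] gives, up
    to the allowed ambiguities, [x] times the Bezoutian of the powers [X_i^N],
    because two difference quotients of the same sequence differ by Koszul
    relations, which do not affect the determinant ([transition_difference]).
    So taking the coefficient of the socle monomial is a functional whose
    contraction is [x].

    Surjectivity for [D] and for its transpose [D(Y,X)] also settles injectivity.
    If the contraction of [D] with [phi] vanishes and [y] is the contraction
    of the transpose with [psi], then [phi y] is [psi] applied to the first
    contraction, hence 0 ([contraction_determines]).  Thus [x |-> phi] is a well
    defined map to the dual of [I^sat / I], and it is bijective.

    Naturality holds because [D] is well defined modulo [f(X)] and [f(Y)]: a
    linear substitution [g] multiplies it by [\det g], and a change of
    generators [A] by [\det A]. *)

(** * Determinants modulo an ideal *)

Section IdealCongruence.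
Variables (S : comNzRingType) (J : set S).
Hypothesis idJ : is_ideal J.

Lemma ideal0 : J 0. Proof. by case: idJ. Qed.
Lemma idealD {x y} : J x -> J y -> J (x + y).
Proof. by case: idJ => _ h _; apply: h. Qed.
Lemma idealMl a {x} : J x -> J (a * x).
Proof. by case: idJ => _ _; apply. Qed.
Lemma ideal_mulr a {x} : J x -> J (x * a).
Proof. by rewrite mulrC; apply: idealMl. Qed.
Lemma idealN {x} : J x -> J (- x).
Proof. by rewrite -mulN1r; apply: idealMl. Qed.
Lemma idealB {x y} : J x -> J y -> J (x - y).
Proof. by move=> hx /idealN; apply: idealD. Qed.
Lemma ideal_trans {x y z} : J (x - y) -> J (y - z) -> J (x - z).
Proof. by move=> h /(idealD h); rewrite addrA subrK. Qed.
Lemma ideal_sum (T : Type) (s : seq T) (Q : pred T) (F : T -> S) :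
  (forall i, Q i -> J (F i)) -> J (\sum_(i <- s | Q i) F i).
Proof.
move=> h; elim/big_ind: _ => //; first exact: ideal0.
by move=> x y; apply: idealD.
Qed.

Lemma ideal_subM {a b c d} : J (a - b) -> J (c - d) -> J (a * c - b * d).
Proof.
move=> /(ideal_mulr c) h1 /(idealMl b) h2; move: (idealD h1 h2).
by rewrite mulrBl mulrBr addrA subrK.
Qed.

Lemma ideal_subX {a b} k : J (a - b) -> J (a ^+ k - b ^+ k).
Proof.
move=> h; elim: k => [|k IH]; first by rewrite subrr; apply: ideal0.
by rewrite !exprS; apply: ideal_subM.
Qed.

Lemma det_congr n (T T' : 'M[S]_n) :
  (forall i j, J (T i j - T' i j)) -> J (\det T - \det T').
Proof.
move=> h; rewrite /determinant -sumrB; apply: ideal_sum => s _.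
rewrite -mulrBr; apply: idealMl.
elim/big_rec2: _ => [|i x y _]; first by rewrite subrr; apply: ideal0.
exact: ideal_subM.
Qed.

Lemma cofactor_row_eq n (N N' : 'M[S]_n) j0 :
  (forall i j, i != j0 -> N i j = N' i j) ->
  forall a, cofactor N j0 a = cofactor N' j0 a.
Proof.
move=> h a; rewrite /cofactor; congr (_ * \det _); apply/matrixP=> i j.
by rewrite !mxE h // eq_sym neq_lift.
Qed.

(** Replace row [j0] by the basis vector [e_b]; the adjugate of the resulting
    matrix, applied to its product with [v], returns its determinant times
    [v]. *)
Lemma cofactor_proportional n (N : 'M[S]_n) (v : 'cV[S]_n) j0 a b :
  (forall k, k != j0 -> J ((N *m v) k 0)) ->
  J (v b 0 * cofactor N j0 a - v a 0 * cofactor N j0 b).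
Proof.
move=> h; pose N' := \matrix_(i, j) if i == j0 then (j == b)%:R else N i j.
have eqN i j : i != j0 -> N' i j = N i j by rewrite mxE => /negPf ->.
rewrite -!(cofactor_row_eq eqN).
have det' : \det N' = cofactor N' j0 b.
  rewrite (expand_det_row _ j0) (bigD1 b) //= !mxE !eqxx mul1r big1 ?addr0 //.
  by move=> j /negPf ne; rewrite mxE eqxx ne mul0r.
have row0 : (N' *m v) j0 0 = v b 0.
  rewrite mxE (bigD1 b) //= !mxE !eqxx mul1r big1 ?addr0 //.
  by move=> j /negPf ne; rewrite mxE eqxx ne mul0r.
have := congr1 (fun M : 'cV_n => M a 0) (mulmxA (\adj N') N' v).
rewrite /= mul_adj_mx mul_scalar_mx det' !mxE (bigD1 j0) //= row0 !mxE.
rewrite [_ * v b 0]mulrC [cofactor N' j0 b * _]mulrC => <-.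
rewrite opprD addrA subrr sub0r; apply/idealN/ideal_sum => k ne.
apply: idealMl; have := h k ne; rewrite !mxE.
by under [in X in _ -> X]eq_bigr => i _ do rewrite eqN //.
Qed.

(** Expanding along row [j0] pairs each coefficient [c a b] with a difference
    [v_b cof_a - v_a cof_b], which is in [J] by proportionality. *)
Lemma det_koszul_row n (N : 'M[S]_n) (v : 'cV[S]_n) j0 (c : 'I_n -> 'I_n -> S) :
  (forall k, k != j0 -> J ((N *m v) k 0)) ->
  (forall a, N j0 a = \sum_b (c a b - c b a) * v b 0) ->
  J (\det N).
Proof.
move=> h hc; rewrite (expand_det_row _ j0).
have -> : \sum_a N j0 a * cofactor N j0 a
   = \sum_a \sum_b c a b * (v b 0 * cofactor N j0 a - v a 0 * cofactor N j0 b).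
  under eq_bigr => a _ do rewrite hc mulr_suml.
  under eq_bigr => a _ do under eq_bigr => b _ do
    rewrite -mulrA mulrBl.
  under eq_bigr => a _ do rewrite sumrB.
  rewrite sumrB [X in _ - X]exchange_big -sumrB; apply: eq_bigr => a _.
  by rewrite -sumrB; apply: eq_bigr => b _; rewrite mulrBr.
apply: ideal_sum => a _; apply: ideal_sum => b _; apply: idealMl.
exact: cofactor_proportional.
Qed.

(** Vanishing of the first Koszul homology of [v]. *)
Definition koszul_syzygies n (v : 'cV[S]_n) : Prop :=
  forall w : 'I_n -> S, \sum_a w a * v a 0 = 0 ->
  exists c : 'I_n -> 'I_n -> S, forall a, w a = \sum_b (c a b - c b a) * v b 0.

(** Replacing the rows of [T] one at a time by those of [T'] changes the
    determinant each time by one with a row of syzygies of [v]. *)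
Lemma det_same_image n (T T' : 'M[S]_n) (v : 'cV[S]_n) :
  koszul_syzygies v -> T *m v = T' *m v -> (forall k, J ((T *m v) k 0)) ->
  J (\det T - \det T').
Proof.
move=> syz eqT hJ.
pose H s := \matrix_(i < n, j < n) if (i < s)%N then T' i j else T i j.
have H0 : H 0 = T by apply/matrixP => i j; rewrite mxE.
have Hn : H n = T' by apply/matrixP => i j; rewrite mxE ltn_ord.
have Hv s k : (H s *m v) k 0 = (T *m v) k 0.
  have e : (T' *m v) k 0 = (T *m v) k 0 by rewrite eqT.
  rewrite -[RHS](if_same (k < s)%N) -{1}e !mxE.
  by case: ifP => hk; apply: eq_bigr => j _; rewrite mxE hk.
suff step s : (s <= n)%N -> J (\det (H 0) - \det (H s)).
  by rewrite -{1}H0 -Hn; apply: step.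
elim: s => [|s IH] ltsn; first by rewrite subrr; apply: ideal0.
apply: (ideal_trans (y := \det (H s))); first exact/IH/ltnW.
pose i0 := Ordinal ltsn.
pose M := \matrix_(i, j) if i == i0 then T i j - T' i j else H s i j.
have eqM i j : i != i0 -> M i j = H s i j by rewrite mxE => /negPf ->.
have eqH i j : i != i0 -> H s.+1 i j = H s i j.
  by rewrite !mxE ltnS leq_eqVlt -val_eqE /= => /negPf ->.
have -> : \det (H s) - \det (H s.+1) = \det M.
  rewrite !(expand_det_row _ i0) -sumrB; apply: eq_bigr => j _.
  rewrite (cofactor_row_eq eqM) (cofactor_row_eq eqH) -mulrBl; congr (_ * _).
  by rewrite !mxE eqxx ltnS leqnn ltnn.
have [|c hc] := syz (fun a => T i0 a - T' i0 a).
  have := congr1 (fun M : 'cV_n => M i0 0) eqT; rewrite !mxE => /= e.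
  under eq_bigr => a _ do rewrite mulrBl.
  by rewrite sumrB e subrr.
apply: (@det_koszul_row _ _ v i0 c) => [k ne|a].
  have := hJ k; rewrite -(Hv s) !mxE.
  by under [in X in _ -> X]eq_bigr => i _ do rewrite eqM //.
by rewrite mxE eqxx.
Qed.

(** Bordering [T] by a row of syzygies of [v] contributes nothing but the
    corner, since the bordered matrix still maps [(v, 0)] into [J]. *)
Lemma det_border n (T : 'M[S]_n) (v : 'cV[S]_n) (w : 'rV[S]_n) (u : 'cV[S]_n) x :
  koszul_syzygies v -> w *m v = 0 -> (forall k, J ((T *m v) k 0)) ->
  J (\det (block_mx T u w (x%:M : 'M_1)) - x * \det T).
Proof.
move=> syz hw hT.
have -> : x * \det T = \det (block_mx T u 0 (x%:M : 'M_1)).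
  by rewrite det_ublock det_scalar1 mulrC.
pose i0 : 'I_(n + 1) := rshift n 0.
pose M := block_mx T u w (0 : 'M_1).
have ne0 i : i != i0 -> exists i', i = lshift 1 i'.
  by case: (split_ordP i) => [i' ->|i' ->]; [exists i' | rewrite [i']ord1 eqxx].
have e1 i j : i != i0 -> block_mx T u w (x%:M : 'M_1) i j = M i j.
  by move=> /ne0 [i' ->]; case: (split_ordP j) => j' ->;
    rewrite ?block_mxEul ?block_mxEur.
have e2 i j : i != i0 -> block_mx T u 0 (x%:M : 'M_1) i j = M i j.
  by move=> /ne0 [i' ->]; case: (split_ordP j) => j' ->;
    rewrite ?block_mxEul ?block_mxEur.
rewrite !(expand_det_row _ i0) -sumrB.
rewrite (eq_bigr (fun j => M i0 j * cofactor M i0 j)); last first.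
  move=> j _; rewrite (cofactor_row_eq e1) (cofactor_row_eq e2) -mulrBl.
  congr (_ * _); case: (split_ordP j) => j' ->;
    by rewrite ?block_mxEdl ?block_mxEdr mxE ?subr0 ?subrr // mxE.
rewrite -expand_det_row.
have [|c hc] := syz (fun a => w 0 a).
  by have := congr1 (fun M : 'M_1 => M 0 0) hw; rewrite !mxE.
pose c' (a b : 'I_(n + 1)) := match fintype.split a, fintype.split b with
  | inl a', inl b' => c a' b' | _, _ => 0 end.
have c'l a b : c' (lshift 1 a) (lshift 1 b) = c a b.
  rewrite /c'; case: fintype.splitP => [? /= /val_inj <-|k /= e]; last first.
    by move: (ltn_ord a); rewrite e ltnNge leq_addr.
  case: fintype.splitP => [? /= /val_inj <-//|k /= e].
  by move: (ltn_ord b); rewrite e ltnNge leq_addr.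
have c'r a b : c' (rshift n a) b = 0.
  rewrite /c'; case: fintype.splitP => // k /= e.
  by move: (ltn_ord k); rewrite -e ltnNge leq_addr.
have c'r' a b : c' b (rshift n a) = 0.
  rewrite /c'; case: fintype.splitP => // k /= _; case: fintype.splitP => // k' /= e.
  by move: (ltn_ord k'); rewrite -e ltnNge leq_addr.
pose v' : 'cV_(n + 1) := col_mx v 0.
apply: (@det_koszul_row _ _ v' i0 c').
  move=> k /ne0 [k' ->].
  by rewrite mul_block_col !mulmx0 !addr0 col_mxEu; apply: hT.
have v'0 : v' (rshift n 0) 0 = 0 by rewrite col_mxEd mxE.
move=> a; rewrite big_split_ord /= big_ord1 v'0 mulr0 addr0; case: (split_ordP a) => a' ->.
  rewrite block_mxEdl hc; apply: eq_bigr => b _.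
  by rewrite !c'l col_mxEu.
rewrite block_mxEdr mxE big1 // => b _.
by rewrite c'r c'r' subrr mul0r.
Qed.

End IdealCongruence.

(** * Polynomials in two sets of variables *)

Section ReplaceVariables.
Variables (n : nat) (A : nzRingType) (C : comNzRingType).
Variables (u v : {rmorphism {mpoly A[n]} -> C}).
Hypothesis uvC : forall a, u a%:MP = v a%:MP.
Variable deg : int -> set C.
Hypotheses (deg0 : forall e, deg e 0)
  (degD : forall e x y, deg e x -> deg e y -> deg e (x + y))
  (degM : forall e e' x y, deg e x -> deg e' y -> deg (e + e') (x * y))
  (deg1 : deg 0 1) (degC : forall a, deg 0 (u a%:MP))
  (degu : forall i, deg 1 (u 'X_i)) (degv : forall i, deg 1 (v 'X_i)).

(** Change the variables of a monomial one at a time.  The degree predicate is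
    carried along because the difference quotients of a form must be forms. *)
Lemma replace_monomial m :
  deg (mdeg m)%:Z (v 'X_[m]) /\
  exists c : 'I_n -> C, (forall i, deg ((mdeg m)%:Z - 1) (c i)) /\
    u 'X_[m] - v 'X_[m] = \sum_i c i * (u 'X_i - v 'X_i).
Proof.
move: {2}(mdeg m) (erefl (mdeg m)) => d; elim: d m => [|d IH] m dm.
  have -> : m = 0%MM by apply/eqP; rewrite -mdeg_eq0 dm.
  rewrite mpolyX0 !rmorph1 mdeg0; split => //.
  by exists (fun=> 0); split=> [i|]; rewrite ?subrr ?big1 // => i; rewrite mul0r.
have [i ni] : exists i, m i != 0%N.
  apply/existsP; apply: contraT; rewrite negb_exists => /forallP h.
  suff e : m = 0%MM by rewrite e mdeg0 in dm.
  by apply/mnmP => i; rewrite mnm0E; move/(_ i): h; rewrite negbK => /eqP.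
pose m' := (m - U_(i))%MM.
have em : m = (U_(i) + m')%MM by rewrite addmC submK // lep1mP.
have dm' : mdeg m' = d by move: dm; rewrite em mdegD mdeg1 => -[].
have [hv [c [hc e]]] := IH _ dm'; rewrite dm' in hv hc.
have edeg : (mdeg m)%:Z = 1 + d%:Z by rewrite dm -addn1 PoszD addrC.
rewrite edeg addrAC subrr add0r {1 2 3}em mpolyXD !rmorphM; split; first exact: degM.
exists (fun j => u 'X_i * c j + (j == i)%:R * v 'X_[m']); split.
  move=> j; apply: degD.
    by have := degM (degu i) (hc j); rewrite addrCA subrr addr0.
  by case: eqP => _; rewrite ?mul1r ?mul0r.
under eq_bigr => j _ do rewrite mulrDl -mulrA.
rewrite big_split -mulr_sumr -e /= (bigD1 i) //= eqxx mul1r big1; last first.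
  by move=> j /negPf ->; rewrite !mul0r.
rewrite addr0 mulrBr [v 'X_[m'] * _]mulrC mulrBl.
by rewrite addrA subrK.
Qed.

Lemma replace_variables e p :
  (forall m, m \in msupp p -> deg ((mdeg m)%:Z - 1) `<=` deg e)%classic ->
  exists c : 'I_n -> C, (forall i, deg e (c i)) /\
    u p - v p = \sum_i c i * (u 'X_i - v 'X_i).
Proof.
rewrite {2 3}[p]mpolyE; elim: (msupp p) => [|m s IH] h.
  exists (fun=> 0); split=> //; rewrite big_nil !rmorph0 subrr big1 // => i.
  by rewrite mul0r.
have [|c [hc ec]] := IH; first by move=> m' hm'; apply: h; rewrite inE hm' orbT.
have [_ [c' [hc' ec']]] := replace_monomial m.
exists (fun i => u (p@_m)%:MP * c' i + c i); split=> [i|].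
  apply: degD => //; rewrite -[e]add0r; apply: degM => //.
  by apply: (h m); rewrite ?mem_head.
rewrite big_cons -mul_mpolyC !rmorphD !rmorphM -uvC opprD addrACA -mulrBr ec ec'.
rewrite mulr_sumr -big_split; apply: eq_bigr => i _ /=.
by rewrite mulrDl mulrA.
Qed.

End ReplaceVariables.

Lemma zhomog_mdeg (K : fieldType) n (p : {mpoly K[n]}) e m :
  zhomog e p -> m \in msupp p -> e = (mdeg m)%:Z.
Proof.
case: e => [d /dhomogP h /h -> //|d /eqP ->].
by rewrite msupp0.
Qed.

Section TwoSets.
Variables (K : fieldType) (n : nat).
Local Notation P := {mpoly K[n]}.
Local Notation B := {mpoly {mpoly K[n]}[n]}.

(* The morphisms below are locked so that they are never unfolded into sums over
   monomials. *)
Fact tensor_key : unit. Proof. exact: tt. Qed.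

(** The ring [B] is [P] tensored with itself: its coefficients are polynomials
    in the first set [X] of variables, its indeterminates are the second
    set [Y]. *)
Definition inX : P -> B := locked_with tensor_key (@mpolyC n P).
Definition inY : P -> B := locked_with tensor_key (map_mpoly (@mpolyC n K)).
Definition swapXY : B -> B :=
  locked_with tensor_key (mmap inY (fun i => inX 'X_i)).

Lemma inXE p : inX p = p%:MP. Proof. by rewrite /inX unlock. Qed.
Lemma inYE p : inY p = map_mpoly (@mpolyC n K) p.
Proof. by rewrite /inY unlock. Qed.

Lemma inX_zmod : zmod_morphism inX.
Proof. by rewrite /inX unlock; apply: rmorphB. Qed.
Lemma inX_monoid : monoid_morphism inX.
Proof. by rewrite /inX unlock; split; [apply: rmorph1 | apply: rmorphM]. Qed.
HB.instance Definition _ := GRing.isZmodMorphism.Build P B inX inX_zmod.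
HB.instance Definition _ := GRing.isMonoidMorphism.Build P B inX inX_monoid.

Lemma inY_zmod : zmod_morphism inY.
Proof. by rewrite /inY unlock; apply: rmorphB. Qed.
Lemma inY_monoid : monoid_morphism inY.
Proof. by rewrite /inY unlock; split; [apply: rmorph1 | apply: rmorphM]. Qed.
HB.instance Definition _ := GRing.isZmodMorphism.Build P B inY inY_zmod.
HB.instance Definition _ := GRing.isMonoidMorphism.Build P B inY inY_monoid.

Lemma swapXY_zmod : zmod_morphism swapXY.
Proof. by rewrite /swapXY unlock; apply: rmorphB. Qed.
Lemma swapXY_monoid : monoid_morphism swapXY.
Proof. by rewrite /swapXY unlock; split; [apply: rmorph1 | apply: rmorphM]. Qed.
HB.instance Definition _ := GRing.isZmodMorphism.Build B B swapXY swapXY_zmod.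
HB.instance Definition _ :=
  GRing.isMonoidMorphism.Build B B swapXY swapXY_monoid.

Lemma inY_X m : inY 'X_[m] = 'X_[m].
Proof. by rewrite inYE map_mpolyX. Qed.

Lemma inXY_C c : inX c%:MP = inY c%:MP.
Proof. by rewrite inXE inYE map_mpolyC. Qed.

Lemma tensor_ind (Q : B -> Prop) :
  Q 0 -> (forall F G, Q F -> Q G -> Q (F + G)) ->
  (forall p q, Q (inX p * inY q)) -> forall F, Q F.
Proof.
move=> Q0 QD QM F; rewrite [F]mpolyE; elim/big_ind: _ => // m _.
by rewrite -mul_mpolyC -inXE -inY_X; apply: QM.
Qed.

Lemma swapX p : swapXY (inX p) = inY p.
Proof. by rewrite /swapXY unlock inXE; apply: mmapC. Qed.

Lemma swap_var m : swapXY 'X_[m] = inX 'X_[m].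
Proof.
rewrite /swapXY unlock mmapX /mmap1 [in RHS]mpolyXE_id rmorph_prod.
by apply: eq_bigr => i _; rewrite rmorphXn.
Qed.

Lemma swapY p : swapXY (inY p) = inX p.
Proof.
elim/mpolyind: p => [|c m p _ _ IH]; first by rewrite !rmorph0.
rewrite !rmorphD /= IH -mul_mpolyC !rmorphM /= -inXY_C inY_X swapX swap_var.
by rewrite inXY_C.
Qed.

Lemma swapXYK F : swapXY (swapXY F) = F.
Proof.
elim/tensor_ind: F => [|F G hF hG|p q]; first by rewrite !rmorph0.
  by rewrite !rmorphD /= hF hG.
by rewrite rmorphM /= swapX swapY rmorphM /= swapX swapY.
Qed.

(** ** Total degree *)

(** Total degree in both sets of variables, presented by pure tensors so that
    contractions can be computed on them. *)
Inductive tdeg (e : int) : B -> Prop :=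
| tdeg_zero : tdeg e 0
| tdeg_add F G : tdeg e F -> tdeg e G -> tdeg e (F + G)
| tdeg_tensor a b p q :
    zhomog a p -> zhomog b q -> a + b = e -> tdeg e (inX p * inY q).

Lemma tdegM e e' F G : tdeg e F -> tdeg e' G -> tdeg (e + e') (F * G).
Proof.
move=> hF hG; elim: hF => [|F1 F2 _ h1 _ h2|a b p q hp hq <-].
- by rewrite mul0r; apply: tdeg_zero.
- by rewrite mulrDl; apply: tdeg_add.
elim: hG => [|F1 F2 _ h1 _ h2|a' b' p' q' hp' hq' <-].
- by rewrite mulr0; apply: tdeg_zero.
- by rewrite mulrDr; apply: tdeg_add.
rewrite mulrACA -!rmorphM addrACA.
by apply: (tdeg_tensor (a := a + a') (b := b + b')); rewrite // ?zhomogM.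
Qed.

Lemma tdeg_inX e p : zhomog e p -> tdeg e (inX p).
Proof.
move=> hp; rewrite -[inX p]mulr1 -[1](rmorph1 inY).
by apply: (tdeg_tensor (a := e) (b := 0)); rewrite ?addr0 //; apply: dhomog1.
Qed.

Lemma tdeg_inY e p : zhomog e p -> tdeg e (inY p).
Proof.
move=> hp; rewrite -[inY p]mul1r -[1](rmorph1 inX).
by apply: (tdeg_tensor (a := 0) (b := e)); rewrite ?add0r //; apply: dhomog1.
Qed.

Lemma tdeg_swap e (F : B) : tdeg e F -> tdeg e (swapXY F).
Proof.
elim=> [|F1 F2 _ h1 _ h2|a b p q hp hq ab].
- by rewrite rmorph0; apply: tdeg_zero.
- by rewrite rmorphD; apply: tdeg_add.
- rewrite rmorphM /= swapX swapY mulrC; apply: tdeg_tensor hq hp _.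
  by rewrite addrC.
Qed.

Lemma zhomog_C (c : K) : zhomog 0 (c%:MP : P).
Proof. by rewrite /= -alg_mpolyC; apply/dhomogZ/dhomog1. Qed.

Lemma zhomog_X i : zhomog 1 ('X_i : P).
Proof. by rewrite /= dhomogX; apply/eqP/mdeg1. Qed.

Lemma tdeg_sign e k F : tdeg e F -> tdeg e ((-1) ^+ k * F).
Proof.
move=> hF; rewrite -[e]add0r; apply: tdegM => //.
rewrite -(rmorph_sign inX) -(rmorph_sign (@mpolyC n K)); apply: tdeg_inX.
exact: zhomog_C.
Qed.

Lemma tdeg_det m (e : 'I_m -> int) (T : 'M[B]_m) :
  (forall i j, tdeg (e i) (T i j)) -> tdeg (\sum_i e i) (\det T).
Proof.
move=> h; rewrite /determinant.
apply: (big_ind (tdeg _)) => [||s _]; [exact: tdeg_zero | exact: tdeg_add |].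
apply: tdeg_sign; elim/big_rec2: _ => [|i y F _].
  by rewrite -(rmorph1 inX); apply/tdeg_inX/dhomog1.
exact: tdegM.
Qed.

(** ** The differences of the variables *)

Definition zdiff i : B := inX 'X_i - inY 'X_i.
Definition zvec : 'cV[B]_n := \col_i zdiff i.

Lemma difference_quotient e p : zhomog e p ->
  exists c : 'I_n -> B, (forall i, tdeg (e - 1) (c i)) /\
    inX p - inY p = \sum_i c i * zdiff i.
Proof.
move=> hp; apply: (replace_variables (u := inX) (v := inY)).
- exact: inXY_C.
- exact: tdeg_zero.
- exact: tdeg_add.
- exact: tdegM.
- by rewrite -(rmorph1 inX); apply/tdeg_inX/dhomog1.
- by move=> a; apply: tdeg_inX; apply: zhomog_C.
- by move=> i; apply/tdeg_inX/zhomog_X.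
- by move=> i; apply/tdeg_inY/zhomog_X.
by move=> m /(zhomog_mdeg hp) ->.
Qed.

Lemma difference_quotient_ex p :
  exists c : 'I_n -> B, inX p - inY p = \sum_i c i * zdiff i.
Proof.
have [] := replace_variables (u := inX) (v := inY) (deg := fun=> setT)
  inXY_C _ _ _ _ _ _ _ (e := 0) (p := p) _ => //.
by move=> c [_ ?]; exists c.
Qed.

(** The quotient map of [B] by the first [s] differences, realised as an
    endomorphism. *)
Definition fuse s : B -> B := locked_with tensor_key
  (mmap (@mpolyC n P) (fun i : 'I_n => if (i < s)%N then inX 'X_i else 'X_i)).

Lemma fuse_zmod s : zmod_morphism (fuse s).
Proof. by rewrite /fuse unlock; apply: rmorphB. Qed.
Lemma fuse_monoid s : monoid_morphism (fuse s).
Proof. by rewrite /fuse unlock; split; [apply: rmorph1 | apply: rmorphM]. Qed.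
HB.instance Definition _ s :=
  GRing.isZmodMorphism.Build B B (fuse s) (fuse_zmod s).
HB.instance Definition _ s :=
  GRing.isMonoidMorphism.Build B B (fuse s) (fuse_monoid s).

Lemma fuse_inX s p : fuse s (inX p) = inX p.
Proof. by rewrite /fuse unlock inXE mmapC. Qed.

Lemma fuse_var s i : fuse s 'X_i = if (i < s)%N then inX 'X_i else 'X_i.
Proof. by rewrite /fuse unlock mmapX mmap1U. Qed.

Lemma fuse_z s i : fuse s (zdiff i) = if (i < s)%N then 0 else zdiff i.
Proof.
rewrite /zdiff rmorphB inY_X /= fuse_var fuse_inX.
by case: ifP; rewrite // subrr.
Qed.

Lemma fuse_kernel s F : fuse s F = 0 ->
  exists c : 'I_n -> B, F = \sum_(i < n | (i < s)%N) c i * zdiff i.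
Proof.
move=> hF.
have [] := replace_variables (u := idfun) (v := fuse s) (deg := fun=> setT)
   _ _ _ _ _ _ _ _ (e := 0) (p := F) _ => //.
  by move=> a; rewrite /= -inXE fuse_inX.
move=> c [_ /=]; rewrite hF subr0 => ->; exists (fun i => - c i).
rewrite [RHS]big_mkcond; apply: eq_bigr => i _.
rewrite fuse_var; case: ifP => _; last by rewrite subrr mulr0.
by rewrite /zdiff inY_X mulNr -mulrN opprB.
Qed.

Lemma zdiff_neq0 i : zdiff i != 0.
Proof.
apply/eqP => /(congr1 (mcoeff U_(i)%MM)); rewrite /zdiff inY_X mcoeffB mcoeff0.
rewrite inXE mcoeffC mcoeffX eqxx mnm1_eq0 mulr0 sub0r => /eqP.
by rewrite oppr_eq0 oner_eq0.
Qed.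

(** The differences form a regular sequence, because setting the first [s] of
    them to zero leaves the next one nonzero in the domain [B]; hence their
    syzygies are the Koszul ones. *)
Lemma zvec_syzygies : koszul_syzygies zvec.
Proof.
suff H s : (s <= n)%N -> forall w : 'I_n -> B,
    (forall i : 'I_n, (s <= i)%N -> w i = 0) -> \sum_a w a * zdiff a = 0 ->
    exists c : 'I_n -> 'I_n -> B,
      forall a, w a = \sum_b (c a b - c b a) * zdiff b.
  move=> w hw; have [||c hc] := H n (leqnn n) w.
  - by move=> i; rewrite leqNgt ltn_ord.
  - by rewrite -[RHS]hw; apply: eq_bigr => a _; rewrite mxE.
  by exists c => a; rewrite hc; apply: eq_bigr => b _; rewrite mxE.
elim: s => [_ w h _|s IH lts w h hw].
  exists (fun _ _ => 0) => a; rewrite h // big1 // => b _.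
  by rewrite subrr mul0r.
pose s0 := Ordinal lts.
have fw : fuse s (w s0) = 0.
  have /(congr1 (fuse s)) := hw.
  rewrite rmorph0 rmorph_sum (bigD1 s0) //= big1 => [|i ne].
    rewrite addr0 rmorphM /= fuse_z ltnn => hz.
    have /orP[/eqP //|z0] := mpoly_idomainAxiom (R := {mpoly K[n]}) hz.
    by case/negP: (zdiff_neq0 s0).
  rewrite rmorphM /= fuse_z; case: ltngtP => [_|lt|e]; rewrite ?mulr0 //.
    by rewrite h // rmorph0 mul0r.
  by case/eqP: ne; apply: val_inj.
have [e he] := fuse_kernel fw.
pose d (a b : 'I_n) : B := if (a == s0) && (b < s)%N then e b else 0.
have dS a : a != s0 -> forall b, d a b = 0 by move=> /negPf ne b; rewrite /d ne.
have ds0 : \sum_b d s0 b * zdiff b = w s0.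
  rewrite he [RHS]big_mkcond; apply: eq_bigr => b _; rewrite /d eqxx /=.
  by case: ifP; rewrite ?mul0r.
pose k a := \sum_b (d a b - d b a) * zdiff b.
have kz : \sum_a k a * zdiff a = 0.
  rewrite /k; under eq_bigr => a _ do rewrite mulr_suml.
  under eq_bigr => a _ do under eq_bigr => b _ do rewrite -mulrA mulrBl.
  under eq_bigr => a _ do rewrite sumrB.
  rewrite sumrB [X in _ - X]exchange_big /=; apply/eqP; rewrite subr_eq0.
  apply/eqP; apply: eq_bigr => a _; apply: eq_bigr => b _.
  by rewrite [zdiff a * _]mulrC.
have [|||c hc] := IH _ (fun a => w a - k a).
- exact: ltnW.
- move=> i lei; case: (eqVneq i s0) => [->|ne].
    rewrite /k; under eq_bigr => b _ do rewrite mulrBl.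
    rewrite sumrB ds0 big1 ?subr0 ?subrr // => b _.
    by rewrite /d ltnn andbF mul0r.
  rewrite h; last by rewrite ltn_neqAle lei andbT eq_sym; move: ne; rewrite -val_eqE.
  rewrite /k big1 ?subrr // => b _.
  by rewrite (dS _ ne) /d (ltnNge i) lei andbF subrr mul0r.
- under eq_bigr => a _ do rewrite mulrBl.
  by rewrite sumrB hw kz subrr.
exists (fun a b => c a b + d a b) => a.
have := hc a; move/(congr1 (+%R^~ (k a))); rewrite subrK => ->.
rewrite /k -big_split; apply: eq_bigr => b _ /=.
by rewrite -mulrDl opprD addrACA.
Qed.

(** ** Contraction with a functional *)

(** The contraction [phi \otimes id] of [P \otimes P] with a functional. *)
Definition slice (phi : {scalar P}) : B -> P :=
  locked_with tensor_key (map_mpoly phi).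

Lemma slice_zmod phi : zmod_morphism (slice phi).
Proof. by rewrite /slice unlock; apply: raddfB. Qed.
HB.instance Definition _ phi :=
  GRing.isZmodMorphism.Build B P (slice phi) (slice_zmod phi).

Lemma sliceXY (phi : {scalar P}) p q :
  slice phi (inX p * inY q) = phi p *: q.
Proof.
apply/mpolyP => m; rewrite /slice unlock mcoeff_map_mpoly inXE mcoeffCM inYE.
rewrite mcoeff_map_mpoly mcoeffZ; transitivity (phi (q@_m *: p)).
  by rewrite -mul_mpolyC mulrC.
by rewrite linearZ; exact: mulrC.
Qed.

Lemma slice_mulY phi p F : slice phi (inY p * F) = p * slice phi F.
Proof.
elim/tensor_ind: F => [|F G hF hG|a b]; first by rewrite mulr0 !raddf0 mulr0.
  by rewrite mulrDr !raddfD /= hF hG mulrDr.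
by rewrite mulrCA -rmorphM !sliceXY scalerAr.
Qed.

Lemma slice_mulX (phi psi : {scalar P}) q F :
  (forall p, psi p = phi (q * p)) -> slice phi (inX q * F) = slice psi F.
Proof.
move=> h; elim/tensor_ind: F => [|F G hF hG|a b]; first by rewrite mulr0 !raddf0.
  by rewrite mulrDr !raddfD /= hF hG.
by rewrite mulrA -rmorphM !sliceXY h.
Qed.

(** Both sides are the value of [phi \otimes psi], up to the order of the
    factors. *)
Lemma slice_swap (phi psi : {scalar P}) F :
  phi (slice psi F) = psi (slice phi (swapXY F)).
Proof.
elim/tensor_ind: F => [|F G hF hG|a b]; first by rewrite !raddf0.
  by rewrite !raddfD /= hF hG.
rewrite rmorphM /= swapX swapY [inY a * _]mulrC !sliceXY !linearZ.
exact: mulrC.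
Qed.

Lemma slice_zcomp (phi psi : {scalar P}) e k F :
  (forall p, psi p = phi (zcomp (e - k) p)) -> tdeg e F ->
  slice psi F = zcomp k (slice phi F).
Proof.
move=> h; elim=> [|F1 F2 _ h1 _ h2|a b p q hp hq ab].
- by rewrite !raddf0 zcomp0.
- rewrite !raddfD /= h1 h2 -[zcomp k (slice phi F1)]scale1r -zcomp_linear.
  by rewrite scale1r.
have zZ c : zcomp k (c *: q) = c *: zcomp k q.
  by rewrite -[c *: q]addr0 zcomp_linear zcomp0 addr0.
rewrite !sliceXY h zZ -ab; case: (eqVneq k b) => [->|ne].
  by rewrite addrK (zcomp_id hp) (zcomp_id hq).
rewrite (zcomp_neq hq ne) scaler0 (zcomp_neq hp) ?raddf0 ?scale0r //.
apply: contra ne; rewrite -addrA -{2}[a]addr0 => /eqP/addrI/eqP.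
by rewrite subr_eq0 eq_sym.
Qed.

End TwoSets.

(** * The transition determinant *)

Section Transition.
Variables (A : comNzRingType) (n : nat).
Variables (f y : 'I_n -> A) (b : 'M[A]_n) (b' : 'cV[A]_n) (u : 'rV[A]_n) (H x : A).
Hypotheses (hb : forall i, y i = \sum_j b i j * f j + b' i 0 * H)
  (hu : x * H = \sum_j u 0 j * f j).

(** Here [x * H] lies in the ideal [(f)] and the [y_i] in [(f, H)].  Formally
    [H] is [\sum_j u_j f_j / x], so [b + b' u / x] expresses [y] in terms of
    [f]; the determinant below is [x] times the one of that matrix, made
    meaningful without dividing by [x]. *)
Definition transition_mx := block_mx b (- b') u (x%:M : 'M_1).
Definition transition : A := \det transition_mx.

(** Cramer's rule, since the matrix maps [(f, - H)] to [(y, 0)]. *)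
Lemma transition_kills j : exists a : 'I_n -> A,
  transition * f j = \sum_i a i * y i.
Proof.
pose V := col_mx (\col_j f j) (- H%:M) : 'cV_(n + 1).
have eV : transition_mx *m V = col_mx (\col_i y i) 0.
  rewrite mul_block_col; congr col_mx; apply/matrixP => i k; rewrite ord1 !mxE.
    rewrite big_ord1 !mxE mulr1n mulrNN hb.
    by congr (_ + _); apply: eq_bigr => k' _; rewrite mxE.
  rewrite big_ord1 !mxE (ord1 k) !mulr1n mulrN hu.
  by under eq_bigr => k' _ do rewrite mxE; rewrite subrr.
have := congr1 (fun M : 'cV_(n + 1) => M (lshift 1 j) 0)
  (mulmxA (\adj transition_mx) transition_mx V).
have z0 a : (0 : 'cV[A]_1) a 0 = 0 by rewrite mxE.
rewrite eV mul_adj_mx mul_scalar_mx /= [RHS]mxE col_mxEu -/transition.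
rewrite [X in _ = _ * X]mxE mxE big_split_ord /= big_ord1 col_mxEd z0 mulr0 addr0.
move=> <-; exists (fun i => (\adj transition_mx) (lshift 1 j) (lshift 1 i)).
by apply: eq_bigr => i _; rewrite col_mxEu [(\col_i0 y i0) _ _]mxE.
Qed.

Variables (C : comNzRingType) (al be : {rmorphism A -> C}) (z : 'cV[C]_n).
Hypotheses (syz : koszul_syzygies z)
  (hz : forall p, exists c : 'rV[C]_n, al p - be p = (c *m z) 0 0).
Variables (T : 'M[C]_n) (g : 'I_n -> C).
Hypotheses (hT : T *m z = \col_j (al (f j) - be (f j)))
  (hg : forall i, g i * z i 0 = al (y i) - be (y i)).

(** Contracting [T] with the bordered transition matrix gives, modulo [J], a
    difference-quotient matrix for [y] bordered by a row of syzygies. *)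
Lemma transition_difference (J : set C) :
  is_ideal J -> (forall j, J (be (f j))) -> J (be H) ->
  (forall i, J (al (y i))) ->
  J (al transition * \det T - be x * \prod_i g i).
Proof.
move=> iJ Jf JH JX.
have JXY i : J (al (y i) - be (y i)).
  apply: (idealB iJ) => //; rewrite hb rmorphD rmorph_sum rmorphM /=.
  apply: (idealD iJ); last exact: (idealMl iJ).
  by apply: (ideal_sum iJ) => j _; rewrite rmorphM; apply/(idealMl iJ)/Jf.
have [dq hdq] := choice hz.
pose E := dq H.
pose bX := map_mx al b; pose b'X := map_mx al b'.
pose uX := map_mx al u; pose xX := al x.
pose T1 := bX *m T + b'X *m E.
pose w := uX *m T - xX *: E.
have eD : al transition * \det T = \det (block_mx T1 (- b'X) w (xX%:M : 'M_1)).
  pose Mb := block_mx bX (- b'X) uX (xX%:M : 'M_1).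
  pose MT : 'M_(n + 1) := block_mx T 0 0 (1%:M : 'M_1).
  pose ME : 'M_(n + 1) := block_mx 1%:M 0 (- E) (1%:M : 'M_1).
  have -> : al transition = \det Mb.
    rewrite -[al _](det_map_mx al) map_block_mx map_mxN.
    by rewrite map_scalar_mx.
  have dD : \det MT = \det T by rewrite det_ublock det1 mulr1.
  have dC : \det ME = 1 by rewrite det_lblock !det1 mulr1.
  transitivity (\det (Mb *m MT *m ME)); first by rewrite !det_mulmx dC mulr1 dD.
  congr (\det _); rewrite !mulmx_block !mulmx0 !mulmx1 !addr0 !add0r.
  by rewrite !mulNmx !mulmxN opprK mul_scalar_mx.
(* [T1] and [w] are corrected by elements of [J] so as to map [z] exactly to
   the differences of [y] and to 0. *)
pose T1' := T1 + \matrix_(i, k) (\sum_j dq (b i j) 0 k * be (f j)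
                                 + dq (b' i 0) 0 k * be H).
pose w' := w + \row_k (\sum_j dq (u 0 j) 0 k * be (f j) - dq x 0 k * be H).
have JT1 i k : J (T1 i k - T1' i k).
  rewrite [T1' i k]mxE opprD addrA subrr sub0r mxE; apply: (idealN iJ).
  apply: (idealD iJ); last exact: (idealMl iJ).
  by apply: (ideal_sum iJ) => j _; apply: (idealMl iJ).
have Jw k : J (w 0 k - w' 0 k).
  rewrite [w' 0 k]mxE opprD addrA subrr sub0r mxE; apply: (idealN iJ).
  apply: (idealB iJ); last exact: (idealMl iJ).
  by apply: (ideal_sum iJ) => j _; apply: (idealMl iJ).
have Tz : T *m z = \col_j al (f j) - \col_j be (f j).
  by rewrite hT; apply/matrixP => j k; rewrite !mxE.
have Ez : E *m z = (al H - be H)%:M.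
  by apply/matrixP => j k; rewrite !ord1 -hdq mxE mulr1n.
have sum_dq m (q : 'I_m -> A) (F : 'I_m -> C) :
    \sum_k (\sum_j dq (q j) 0 k * F j) * z k 0
    = \sum_j al (q j) * F j - \sum_j be (q j) * F j.
  under eq_bigr => k _ do rewrite mulr_suml.
  rewrite exchange_big -sumrB; apply: eq_bigr => j _ /=.
  rewrite -mulrBl hdq mxE mulr_suml; apply: eq_bigr => k _.
  by rewrite mulrAC.
have sum_dq1 q F : \sum_k (dq q 0 k * F) * z k 0
    = al q * F - be q * F.
  rewrite -mulrBl hdq mxE mulr_suml; apply: eq_bigr => k _.
  by rewrite mulrAC.
have T1'z : T1' *m z = \col_i (al (y i) - be (y i)).
  rewrite mulmxDl mulmxDl -!mulmxA Tz Ez mulmxBr mul_mx_scalar.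
  apply/matrixP => i k; rewrite ord1 !mxE.
  under [X in _ + X = _]eq_bigr => j _ do rewrite !mxE mulrDl.
  rewrite big_split /= sum_dq sum_dq1 hb !rmorphD !rmorph_sum /= !rmorphM /=.
  under [X in X - _ + _ + _]eq_bigr => j _ do rewrite !mxE -rmorphM.
  under [X in _ - X + _ + _]eq_bigr => j _ do rewrite !mxE.
  under [X in _ + (_ - X + _) = _]eq_bigr => j _ do rewrite -rmorphM.
  ring.
have w'z : w' *m z = 0.
  rewrite mulmxDl mulmxBl -mulmxA -scalemxAl Tz Ez mulmxBr.
  apply/matrixP => i k; rewrite !ord1 !mxE mulr1n.
  under [X in _ + X = _]eq_bigr => j _ do rewrite !mxE mulrBl.
  rewrite sumrB /= sum_dq sum_dq1.
  under eq_bigr => j _ do rewrite !mxE -rmorphM.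
  under [X in _ - X - _ + _]eq_bigr => j _ do rewrite !mxE.
  under [X in _ + (_ - X - _)]eq_bigr => j _ do rewrite -rmorphM.
  rewrite -!rmorph_sum -hu !rmorphM.
  ring.
apply: (ideal_trans iJ (y := xX * \det T1')).
  apply: (ideal_trans iJ (y := \det (block_mx T1' (- b'X) w' (xX%:M : 'M_1)))).
    rewrite eD; apply: (det_congr iJ) => i j.
    case: (split_ordP i) => i' ->; case: (split_ordP j) => j' ->;
      rewrite ?block_mxEul ?block_mxEur ?block_mxEdl ?block_mxEdr //.
    - by rewrite subrr; apply: (ideal0 iJ).
    - by rewrite (ord1 i').
    - by rewrite subrr; apply: (ideal0 iJ).
  apply: (det_border iJ _ _ syz) => // k.
  by rewrite T1'z mxE.
apply: (ideal_trans iJ (y := xX * \prod_i g i)).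
  rewrite -mulrBr; apply: (idealMl iJ).
  have -> : \prod_i g i = \det (diag_mx (\row_i g i)).
    by rewrite det_diag; apply: eq_bigr => i _; rewrite mxE.
  apply: (det_same_image iJ syz) => [|k]; last by rewrite T1'z mxE.
  rewrite T1'z; apply/matrixP => i j; rewrite ord1 mul_diag_mx !mxE.
  by rewrite hg.
rewrite -mulrBl hdq mxE mulr_suml; apply: (ideal_sum iJ) => k _.
rewrite -mulrA; apply: (idealMl iJ); rewrite (bigD1 k) //= mulrA.
by apply: (ideal_mulr iJ); rewrite mulrC hg.
Qed.

End Transition.

(** * Bezoutians and residues *)

Section Bezoutians.
Variables (K : fieldType) (n : nat).
Local Notation P := {mpoly K[n]}.
Local Notation B := {mpoly {mpoly K[n]}[n]}.
Implicit Types (f : 'I_n -> P) (T : 'M[B]_n).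

Definition bezoutian f T : Prop :=
  T *m zvec K n = \col_j (inX (f j) - inY (f j)).

Lemma bezoutianP f T : bezoutian f T <->
  forall j, \sum_k T j k * zdiff K k = inX (f j) - inY (f j).
Proof.
split=> [h j|h].
  have := congr1 (fun M : 'cV_n => M j 0) h; rewrite /= [RHS]mxE => <-.
  by rewrite mxE; apply: eq_bigr => k _; rewrite [zvec _ _ _ _]mxE.
apply/matrixP => j i; rewrite ord1 [RHS]mxE -h mxE; apply: eq_bigr => k _.
by rewrite [zvec _ _ _ _]mxE.
Qed.

Lemma bezoutian_homog (e : 'I_n -> int) f :
  (forall j, zhomog (e j) (f j)) ->
  exists2 T, bezoutian f T & forall j i, tdeg (e j - 1) (T j i).
Proof.
move=> hf; have [c hc] := choice (fun j => difference_quotient (hf j)).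
exists (\matrix_(j, i) c j i) => [|j i]; last by rewrite mxE; case: (hc j).
apply/bezoutianP => j; case: (hc j) => _ ->.
by apply: eq_bigr => k _; rewrite mxE.
Qed.

Lemma bezoutian_swap f T :
  bezoutian f T -> bezoutian f (map_mx (@swapXY K n) T).
Proof.
move=> /bezoutianP hT; apply/bezoutianP => j.
have e : swapXY (inX (f j) - inY (f j)) = inY (f j) - inX (f j).
  by rewrite rmorphB /= swapX swapY.
apply: oppr_inj; rewrite opprB -e -hT rmorph_sum.
rewrite -sumrN; apply: eq_bigr => k _; rewrite mxE rmorphM -mulrN; congr (_ * _).
by rewrite rmorphB /= swapX swapY opprB.
Qed.

Lemma bezoutian_det_unique (J : set B) f T T' :
  is_ideal J -> (forall j, J (inX (f j) - inY (f j))) ->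
  bezoutian f T -> bezoutian f T' -> J (\det T - \det T').
Proof.
move=> iJ hJ hT hT'; apply: (det_same_image iJ (@zvec_syzygies K n)).
  by rewrite hT hT'.
by move=> k; rewrite hT mxE.
Qed.

Lemma slice0 (psi : {scalar P}) (F : B) :
  (forall p, psi p = 0) -> slice psi F = 0.
Proof.
move=> h; elim/tensor_ind: F => [|F G hF hG|p q]; first exact: raddf0.
  by rewrite raddfD /= hF hG addr0.
by rewrite sliceXY h scale0r.
Qed.

Definition scalar_mul (q : P) (phi : {scalar P}) : P -> K := fun p => phi (q * p).
Lemma scalar_mul_scalar q phi : scalar (scalar_mul q phi).
Proof.
by move=> c p p'; rewrite /scalar_mul mulrDr -scalerAr linearP.
Qed.
HB.instance Definition _ q phi :=
  GRing.isLinear.Build K P K _ (scalar_mul q phi) (scalar_mul_scalar q phi).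

(** The largest ideal all of whose contractions with [phi] lie in [L]: the
    congruences between determinants are taken modulo it. *)
Definition contracts_into (phi : {scalar P}) (L : set P) : set B :=
  [set F | forall a, L (slice phi (a * F))]%classic.

Lemma contracts_into_ideal phi L : is_ideal L -> is_ideal (contracts_into phi L).
Proof.
move=> iL; split=> [a|F G hF hG a|c F hF a].
- by rewrite mulr0 raddf0; apply: (ideal0 iL).
- by rewrite mulrDr raddfD; apply: (idealD iL); [apply: hF | apply: hG].
- by rewrite mulrA; apply: hF.
Qed.

Lemma contracts_into_inY phi L s :
  is_ideal L -> L s -> contracts_into phi L (inY s).
Proof. by move=> iL Ls a; rewrite mulrC slice_mulY; apply: (ideal_mulr iL). Qed.

Lemma contracts_into_inX (phi : {scalar P}) L s :
  is_ideal L -> (forall p, phi (s * p) = 0) -> contracts_into phi L (inX s).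
Proof.
move=> iL h a; rewrite mulrC (slice_mulX (psi := scalar_mul s phi)) //.
by rewrite slice0 //; apply: (ideal0 iL).
Qed.

Lemma mcoeff_mulX_eq0 (p : P) (m k : 'X_{1..n}) :
  ~~ (m <= k)%MM -> (p * 'X_[m])@_k = 0.
Proof.
move=> h; elim/mpolyind: p => [|c m' p _ _ IH]; first by rewrite mul0r mcoeff0.
rewrite mulrDl mcoeffD IH addr0 -scalerAl -mpolyXD mcoeffZ mcoeffX.
case: eqP => [e|]; last by rewrite mulr0.
by case/negP: h; rewrite -e lem_addl.
Qed.

Section Residue.
Variable N : nat.
Hypothesis N0 : (0 < N)%N.

(** The exponent of the socle monomial modulo the [N]-th powers. *)
Definition top_exponent : 'X_{1..n} := [multinom N.-1 | _ < n].
Local Notation coef := (mcoeff top_exponent : {scalar P}).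

Lemma coef_powers (p : P) i : coef ('X_i ^+ N * p) = 0.
Proof.
rewrite mulrC mpolyXn /=; apply: mcoeff_mulX_eq0.
apply/negP => /mnm_lepP/(_ i); rewrite mulmnE mnm1E eqxx mul1n mnmE.
by rewrite leqNgt prednK ?leqnn.
Qed.

Definition power_quotient (i : 'I_n) : B :=
  \sum_(a < N) inX ('X_i ^+ (N.-1 - a)) * inY ('X_i ^+ a).

Lemma power_quotientE i :
  power_quotient i * zdiff K i = inX ('X_i ^+ N) - inY ('X_i ^+ N).
Proof.
rewrite !rmorphXn /= subrXX mulrC; congr (_ * _).
by apply: eq_bigr => a _; rewrite !rmorphXn.
Qed.

Lemma slice_power_quotients : slice coef (\prod_i power_quotient i) = 1.
Proof.
rewrite /power_quotient bigA_distr_bigA raddf_sum.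
pose h0 : {ffun 'I_n -> 'I_N} := [ffun=> Ordinal N0].
have term (h : {ffun 'I_n -> 'I_N}) :
    slice coef (\prod_i (inX ('X_i ^+ (N.-1 - h i)) * inY ('X_i ^+ h i)))
    = coef (\prod_i 'X_i ^+ (N.-1 - h i)) *: \prod_i 'X_i ^+ h i.
  by rewrite big_split -!rmorph_prod sliceXY.
rewrite (eq_bigr _ (fun h _ => term h)) /=.
rewrite (bigD1 h0) //= [X in _ + X]big1 => [|h ne].
  rewrite addr0 (eq_bigr (fun i => 'X_i ^+ top_exponent i)); last first.
    by move=> i _; rewrite ffunE /= subn0 mnmE.
  rewrite -mpolyXE_id mcoeffX eqxx scale1r big1 // => i _.
  by rewrite ffunE expr0.
pose m := [multinom (N.-1 - h i)%N | i < n].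
rewrite (eq_bigr (fun i => 'X_i ^+ m i)) => [|i _]; last by rewrite mnmE.
rewrite -mpolyXE_id mcoeffX; case: eqP => [e|]; last by rewrite scale0r.
case/eqP: ne; apply/ffunP => i; apply/val_inj; rewrite ffunE /=.
have := congr1 (fun m : 'X_{1..n} => m i) e; rewrite /= !mnmE.
have : (h i <= N.-1)%N by rewrite -ltnS prednK.
by move=> le /eqP; rewrite -{2}[N.-1]subn0 eqn_sub2lE // => /eqP.
Qed.

Variables (f : 'I_n -> P) (T : 'M[B]_n) (b : 'M[P]_n) (b' : 'cV[P]_n)
  (u : 'rV[P]_n) (H x : P).
Hypotheses (hT : bezoutian f T)
  (hb : forall i, 'X_i ^+ N = \sum_j b i j * f j + b' i 0 * H)
  (hu : x * H = \sum_j u 0 j * f j).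
Local Notation delta := (transition b b' u x).

(** Multiplying by the transition determinant and taking the coefficient of the
    socle monomial is the residue with numerator [x].  By
    [transition_difference] the Bezoutian becomes [x] times that of the powers
    of the variables, whose contraction with this coefficient is 1. *)
Lemma residue_functional (L : set P) :
  is_ideal L -> (forall j, L (f j)) -> L H ->
  exists phi : {scalar P}, (forall q j, phi (q * f j) = 0) /\
    L (slice phi (\det T) - x).
Proof.
move=> iL Lf LH.
exists (scalar_mul delta coef); split=> [q j|].
  have [a ea] := transition_kills hb hu j.
  rewrite /= /scalar_mul mulrCA ea mulr_sumr raddf_sum big1 // => i _.
  by rewrite mulrA mulrC; apply: coef_powers.
have iJ := contracts_into_ideal coef iL.
have JY s : L s -> contracts_into coef L (inY s) by apply: contracts_into_inY.
have JX i : contracts_into coef L (inX ('X_i ^+ N)).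
  by apply: contracts_into_inX => // p; apply: coef_powers.
have hdq p : exists c : 'rV[B]_n, inX p - inY p = (c *m zvec K n) 0 0.
  have [c ->] := difference_quotient_ex p; exists (\row_i c i).
  by rewrite mxE; apply: eq_bigr => i _; rewrite !mxE.
have hg i : power_quotient i * zvec K n i 0 = inX ('X_i ^+ N) - inY ('X_i ^+ N).
  by rewrite mxE power_quotientE.
have := transition_difference hb hu (@zvec_syzygies K n) hdq hT hg iJ
  (fun j => JY _ (Lf j)) (JY _ LH) JX.
move=> /(_ 1); rewrite mul1r raddfB /= slice_mulY slice_power_quotients mulr1.
by rewrite (slice_mulX (psi := scalar_mul delta coef)).
Qed.

End Residue.
End Bezoutians.

(** * Noetherian induction for polynomial ideals *)

Lemma frequently_subsequence (Q : nat -> Prop) :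
  (forall k, exists2 j, (k <= j)%N & Q j) ->
  exists2 g : nat -> nat, forall i, (g i < g i.+1)%N & forall i, Q (g i).
Proof.
move=> h; have {}h k : exists j, (k <= j)%N /\ Q j.
  by have [j ? ?] := h k; exists j.
have [a ha] := choice h.
exists (fun i => iter i (fun k => a k.+1) (a 0%N)) => [i|[|i]] /=.
- by have [] := ha (iter i (fun k => a k.+1) (a 0%N)).+1.
- by have [] := ha 0%N.
- by have [] := ha (iter i (fun k => a k.+1) (a 0%N)).+1.
Qed.

Lemma nondecreasing_subsequence (u : nat -> nat) :
  exists2 g : nat -> nat, forall i, (g i < g i.+1)%N
    & forall i, (u (g i) <= u (g i.+1))%N.
Proof.
have [k|g hg hQ] := @frequently_subsequence
    (fun j => forall i, (j <= i)%N -> (u j <= u i)%N).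
  have [m] := ubnP (u k); elim: m k => // m IH k; rewrite ltnS => le.
  have [h|] := pselect (forall i, (k <= i)%N -> (u k <= u i)%N); first by exists k.
  move=> /existsNP [i /not_implyP [ki /negP]]; rewrite -ltnNge => lt.
  have [|j ij hj] := IH i; first exact: leq_trans lt le.
  by exists j => //; apply: leq_trans ij.
by exists g => // i; apply: hQ; apply/ltnW.
Qed.

(** Dickson's lemma, by extracting a nondecreasing subsequence for one exponent
    after the other. *)
Lemma dickson n (u : nat -> 'X_{1..n}) :
  exists i j, (i < j)%N /\ (u i <= u j)%MM.
Proof.
suff H s : (s <= n)%N -> exists2 g : nat -> nat, forall i, (g i < g i.+1)%N
    & forall (c : 'I_n) i, (c < s)%N -> (u (g i) c <= u (g i.+1) c)%N.
  have [g hg hu] := H n (leqnn n).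
  by exists (g 0%N), (g 1%N); split=> //; apply/mnm_lepP => c; apply: hu.
elim: s => [_|s IH lts]; first by exists id.
have [g hg hu] := IH (ltnW lts).
have [h hh hv] := nondecreasing_subsequence (fun i => u (g i) (Ordinal lts)).
have g_mono : {homo g : i j / (i < j)%N} by apply: homo_ltn => //; apply: ltn_trans.
exists (g \o h) => [i|c i]; first exact: g_mono.
rewrite ltnS leq_eqVlt => /orP[/eqP e|lt] /=.
  by have -> : c = Ordinal lts by apply: val_inj.
have : {homo (fun i => u (g i) c) : i j / (i <= j)%N}.
  by apply: (homo_leq leqnn) => [y x z|j]; [apply: leq_trans | apply: hu].
by apply; apply/ltnW.
Qed.

Section Noetherian.
Variables (K : fieldType) (n : nat).
Local Notation P := {mpoly K[n]}.

Lemma minimal_mlead (D : set P) p : D p ->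
  exists2 g, D g & forall h, D h -> ~~ (mlead h < mlead g)%O.
Proof.
move: {2}(mlead p) (erefl (mlead p)) => m.
elim: (ltom_wf m) p => {}m _ IH p em Dp.
have [h|] := pselect (forall h, D h -> ~~ (mlead h < mlead p)%O).
  by exists p.
move=> /existsNP [h /not_implyP [Dh /negP]]; rewrite negbK em => lt.
exact: (IH _ lt h).
Qed.

(** Choose new elements with minimal leading monomials: by Dickson's lemma one
    of them could be reduced by an earlier one. *)
Lemma ideals_acc (J : nat -> set P) :
  (forall i, is_ideal (J i)) -> (forall i, J i `<=` J i.+1)%classic ->
  ~ forall i, exists2 p, J i.+1 p & ~ J i p.
Proof.
move=> iJ sJ h.
have mono i j : (i <= j)%N -> (J i `<=` J j)%classic.
  move/subnKC <-; elim: (j - i)%N => [|k IH]; first by rewrite addn0.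
  by rewrite addnS; apply: subset_trans IH _.
have {}h i : exists g : P, [/\ J i.+1 g, ~ J i g
    & forall p, J i.+1 p -> ~ J i p -> ~~ (mlead p < mlead g)%O].
  have [p h1 h2] := h i.
  have [g [h3 h4] h5] := @minimal_mlead [set p | J i.+1 p /\ ~ J i p]%classic p
    (conj h1 h2).
  by exists g; split=> // q hq hq'; apply: h5.
have {h} [g hg] := choice h.
have g0 i : g i != 0.
  by apply/eqP => e; case: (hg i) => _; rewrite e => /(_ (ideal0 (iJ i))).
have [i [j [lij le]]] := dickson (fun i => mlead (g i)).
pose c := mleadc (g j) / mleadc (g i).
pose m := (mlead (g j) - mlead (g i))%MM.
have cN0 : c != 0 by rewrite mulf_neq0 // ?invr_eq0 mleadc_eq0.
pose q := c *: 'X_[m] * g i.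
have lq : mlead q = mlead (g j).
  rewrite mleadM ?g0 ?mleadZ ?mleadXm ?submK //.
  by rewrite -mleadc_eq0 mleadcZE mleadXm mcoeffX eqxx mulr1.
have cq : q@_(mlead (g j)) = mleadc (g j).
  rewrite /q -scalerAl mcoeffZ [_ * g i]mulrC -{1}(submK le) mcoeffMX.
  by rewrite /c divfK // mleadc_eq0.
have [hj1 hj2 hj3] := hg j; have [hi1 _ _] := hg i.
have qJ : J j q by apply: (idealMl (iJ j)); apply: mono hi1.
have dJ : ~ J j (g j - q).
  by move=> /(idealD (iJ j)) /(_ qJ); rewrite subrK.
have d0 : g j - q != 0 by apply/eqP => e; apply: dJ; rewrite e; apply: ideal0.
have := hj3 (g j - q) (idealB (iJ j.+1) hj1 (sJ _ _ qJ)) dJ.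
rewrite lt_neqAle negb_and negbK => /orP[/eqP e|/negP]; last first.
  by apply; apply: le_trans (mleadB_le _ _) _; rewrite lq joinxx.
have := mleadc_eq0 (g j - q); rewrite (negPf d0) e mcoeffB cq subrr eqxx.
by [].
Qed.

(** A failure would propagate to strictly larger ideals for ever. *)
Lemma noetherian_ind (Q : set P -> Prop) :
  (forall J, is_ideal J ->
    (forall J', is_ideal J' -> (J `<=` J')%classic -> (exists2 p, J' p & ~ J p) ->
      Q J') -> Q J) ->
  forall J, is_ideal J -> Q J.
Proof.
move=> step J0 iJ0; apply: contrapT => nQ0.
pose bad := {J : set P | is_ideal J /\ ~ Q J}.
have next (J : bad) : exists J' : bad, (sval J `<=` sval J')%classic /\
    exists2 p, sval J' p & ~ sval J p.
  case: J => J [iJ nQ] /=; apply: contrapT => h; apply: nQ; apply: step => //.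
  move=> J' iJ' sJ hp; apply: contrapT => nQ'; apply: h.
  by exists (exist _ J' (conj iJ' nQ')).
have [F hF] := choice next.
pose J i := sval (iter i F (exist _ J0 (conj iJ0 nQ0))).
apply: (@ideals_acc J) => i; rewrite /J /=.
- by case: (iter i F _) => J' [].
- by case: (hF (iter i F (exist _ J0 (conj iJ0 nQ0)))).
- by case: (hF (iter i F (exist _ J0 (conj iJ0 nQ0)))).
Qed.

End Noetherian.

(** * Homogeneous ideals *)

Arguments zcomp : simpl never.

Section Homogeneous.
Variables (K : fieldType) (n : nat).
Local Notation P := {mpoly K[n]}.
Implicit Types (J : set P) (p q a : P).

HB.instance Definition _ e :=
  GRing.isLinear.Build K P P _ (@zcomp K n e) (@zcomp_linear K n e).

Lemma zcomp_large p d : (msize p <= d)%N -> zcomp d p = 0.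
Proof.
move=> le; rewrite /zcomp pihomogE big_seq_cond big1 // => m /andP[mp /eqP e].
by move: (msize_mdeg_lt mp); rewrite e ltnNge le.
Qed.

Lemma zcomp_sum k p : (forall d : nat, (k <= d)%N -> zcomp d p = 0) ->
  p = \sum_(d < k) zcomp d p.
Proof.
move=> h; pose l := maxn k (msize p).
rewrite {1}(pihomog_partitionE (leq_maxr k (msize p))) -/l.
rewrite -(big_mkord predT (fun d => pihomog mdeg d p)).
rewrite (big_cat_nat (leq0n k) (leq_maxl k (msize p))) /= big_mkord.
rewrite [X in _ + X]big_nat_cond [X in _ + X]big1 ?addr0 //.
by move=> d /andP[/andP[kd _] _]; apply: h.
Qed.

Lemma zhomogX m : zhomog (mdeg m)%:Z ('X_[m] : P).
Proof. by rewrite /= dhomogX. Qed.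

Lemma zcompM_homog e e' a p : zhomog e a -> zcomp e' (p * a) = zcomp (e' - e) p * a.
Proof.
move=> ha; elim/mpolyind: p => [|c m p _ _ IH].
  by rewrite !(mul0r, linear0).
rewrite mulrDl !linearD /= IH mulrDl -scalerAl !linearZ /= -scalerAl.
congr (_ *: _ + _); have hm := zhomogM (zhomogX m) ha.
case: (eqVneq e' ((mdeg m)%:Z + e)) => [->|ne].
  by rewrite (zcomp_id hm) addrK (zcomp_id (zhomogX m)).
rewrite (zcomp_neq hm ne) (zcomp_neq (zhomogX m)) ?mul0r //.
by rewrite subr_eq.
Qed.

Lemma zcompM_homogl e e' a p :
  zhomog e a -> zcomp e' (a * p) = a * zcomp (e' - e) p.
Proof. by move=> ha; rewrite mulrC (zcompM_homog _ _ ha) mulrC. Qed.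

Definition homog_ideal J : Prop :=
  is_ideal J /\ forall e p, J p -> J (zcomp e p).

Definition ideal_add J a : set P := [set p | exists s q, J s /\ p = s + q * a]%classic.

Lemma ideal_add_ideal J a : is_ideal J -> is_ideal (ideal_add J a).
Proof.
move=> iJ; split=> [|_ _ [s [q [hs ->]]] [s' [q' [hs' ->]]]|c _ [s [q [hs ->]]]].
- by exists 0, 0; rewrite mul0r addr0; split=> //; apply: ideal0.
- by exists (s + s'), (q + q'); rewrite mulrDl addrACA; split=> //; apply: idealD.
- by exists (c * s), (c * q); rewrite mulrDr mulrA; split=> //; apply: idealMl.
Qed.

Lemma sub_ideal_add J a : (J `<=` ideal_add J a)%classic.
Proof. by move=> s hs; exists s, 0; rewrite mul0r addr0. Qed.

Lemma mem_ideal_add J a : is_ideal J -> ideal_add J a a.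
Proof. by move=> iJ; exists 0, 1; rewrite mul1r add0r; split=> //; apply: ideal0. Qed.

Lemma ideal_add_homog J a e :
  homog_ideal J -> zhomog e a -> homog_ideal (ideal_add J a).
Proof.
move=> [iJ hJ] ha; split=> [|e' _ [s [q [hs ->]]]]; first exact: ideal_add_ideal.
exists (zcomp e' s), (zcomp (e' - e) q); rewrite linearD /=; split; first exact: hJ.
by rewrite (zcompM_homog _ _ ha).
Qed.

Lemma zcomp_zcomp e e' p : zcomp e (zcomp e' p) = if e == e' then zcomp e p else 0.
Proof.
case: eqP => [->|/eqP ne]; first exact/zcomp_id/zcompP.
exact: zcomp_neq (zcompP e' p) ne.
Qed.

(** Compare the highest homogeneous components of two factors of an element of
    [J], stripping them when they lie in [J]. *)
Lemma homog_prime J : homog_ideal J -> ~ J 1 ->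
  (forall a b e e', zhomog e a -> zhomog e' b -> J (a * b) -> J a \/ J b) ->
  is_prime_ideal J.
Proof.
move=> [iJ hJ] J1 prJ; split=> // x y.
pose bound k p := forall d : nat, (k <= d)%N -> zcomp d p = 0.
have [k] : exists k, bound k x by exists (msize x) => d; apply: zcomp_large.
have [l] : exists l, bound l y by exists (msize y) => d; apply: zcomp_large.
have [m] := ubnP (k + l)%N; elim: m k l x y => // m IH k l x y; rewrite ltnS.
case: k => [|k] le hy hx.
  by move=> _; left; rewrite (zcomp_sum hx) big_ord0; apply: ideal0.
case: l le hy => [|l] le hy.
  by move=> _; right; rewrite (zcomp_sum hy) big_ord0; apply: ideal0.
have strip i p : bound i.+1 p -> bound i (p - zcomp i p).
  move=> h d; rewrite linearB /= zcomp_zcomp leq_eqVlt => /orP[/eqP ->|lt].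
    by rewrite eqxx subrr.
  by rewrite eqz_nat gtn_eqF // subr0; apply: h.
move=> Jxy.
have [Jx|nJx] := pselect (J (zcomp k x)).
  have [||||h|] := IH k l.+1 (x - zcomp k x) y => //; last by right.
  - exact: strip.
  - by rewrite mulrBl; apply: (idealB iJ) => //; apply: ideal_mulr.
  - by left; rewrite -[x](subrK (zcomp k x)); apply: (idealD iJ).
have [Jy|nJy] := pselect (J (zcomp l y)).
  have [||||h|h] := IH k.+1 l x (y - zcomp l y) => //.
  - by rewrite addSnnS.
  - exact: strip.
  - by rewrite mulrBr; apply: (idealB iJ) => //; apply: idealMl.
  - by left.
  - by right; rewrite -[y](subrK (zcomp l y)); apply: (idealD iJ).
have [] // : J (zcomp k x) \/ J (zcomp l y).
apply: (prJ _ _ k l); try exact: zcompP.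
have := hJ (k + l)%N _ Jxy; rewrite {1}(zcomp_sum hx) mulr_suml raddf_sum /=.
rewrite big_ord_recr /= big1 => [|i _].
  by rewrite add0r (zcompM_homogl _ _ (zcompP k x)) PoszD addrC addKr.
rewrite (zcompM_homogl _ _ (zcompP i x)).
have lt := ltn_ord i; rewrite subzn; last exact/ltnW/ltn_addr.
by rewrite hy ?mulr0 // ltn_subRL ltn_add2r.
Qed.

(** The closed subset of projective space defined by [J] is empty. *)
Definition contains_powers J : Prop := exists N, forall i, J ('X_i ^+ N).

(** The closed set of [J] is the union of those of [J + (a)] and [J + (b)]. *)
Lemma contains_powers_mul J a b : is_ideal J -> J (a * b) ->
  contains_powers (ideal_add J a) -> contains_powers (ideal_add J b) ->
  contains_powers J.
Proof.
move=> iJ Jab [N hN] [N' hN']; exists (N + N')%N => i.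
have [s [q [hs e]]] := hN i; have [s' [q' [hs' e']]] := hN' i.
rewrite exprD e e' mulrDl; apply: (idealD iJ); first exact: ideal_mulr.
rewrite mulrDr; apply: (idealD iJ); first exact: idealMl.
by rewrite mulrACA; apply: idealMl.
Qed.

(** The points of projective space: a prime ideal containing no power of some
    variable does not contain the irrelevant ideal. *)
Definition relevant_prime (Q : set P) : Prop :=
  [/\ homog_ideal Q, is_prime_ideal Q & ~ contains_powers Q].

(** In terms of the closed set of [J]: it is irreducible, empty, or the union of
    two smaller closed sets. *)
Lemma homog_ideal_cases J : homog_ideal J ->
  [\/ relevant_prime J, contains_powers J |
    exists a b e e', [/\ zhomog e a, zhomog e' b, J (a * b), ~ J a & ~ J b]].
Proof.
move=> hJ; have [iJ _] := hJ.
have [h|nh] := pselect (contains_powers J); first by constructor 2.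
have [h|nab] := pselect (exists a b e e',
  [/\ zhomog e a, zhomog e' b, J (a * b), ~ J a & ~ J b]); first by constructor 3.
constructor 1; split=> //; apply: homog_prime => //.
  by move=> J1; apply: nh; exists 0%N => i; rewrite expr0.
move=> a b e e' ha hb hab; apply: contrapT => /not_orP[nJa nJb].
by apply: nab; exists a, b, e, e'.
Qed.

(** A nonempty closed set has a point, by Noetherian induction. *)
Lemma relevant_prime_exists J : homog_ideal J -> ~ contains_powers J ->
  exists2 Q, relevant_prime Q & (J `<=` Q)%classic.
Proof.
move=> hJ; have [iJ _] := hJ.
move: J iJ hJ; apply: noetherian_ind => J iJ IH hJ nJ.
have [?||[a [b [e [e' [ha hb Jab nJa nJb]]]]]] := homog_ideal_cases hJ => //.
  by exists J.
have step c e'' : zhomog e'' c -> ~ J c -> ~ contains_powers (ideal_add J c) ->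
    exists2 Q, relevant_prime Q & (J `<=` Q)%classic.
  move=> hc nJc nc.
  have [|||||Q hQ sQ] := IH (ideal_add J c) => //.
  - exact: ideal_add_ideal.
  - exact: sub_ideal_add.
  - by exists c => //; apply: mem_ideal_add.
  - exact: ideal_add_homog hc.
  - by exists Q => //; apply: subset_trans (sub_ideal_add c) sQ.
have [pa|/(step _ _ ha nJa) //] := pselect (contains_powers (ideal_add J a)).
have [pb|/(step _ _ hb nJb) //] := pselect (contains_powers (ideal_add J b)).
by case: nJ; apply: contains_powers_mul pa pb.
Qed.

(** ** A linear form avoiding a zero-dimensional closed set *)

Definition zero_dimensional J : Prop := forall Q Q',
  relevant_prime Q -> relevant_prime Q' -> (J `<=` Q)%classic ->
  (Q `<=` Q')%classic -> (Q' `<=` Q)%classic.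

(** The linear forms of the rational normal curve: any [n] distinct ones are
    linearly independent. *)
Definition moment_form (t : nat) : P := \sum_(i < n) (t%:R ^+ i : K) *: 'X_i.

Lemma zhomog_moment_form t : zhomog 1 (moment_form t).
Proof.
apply: rpred_sum => i _; apply: dhomogZ; exact: (zhomog_X K i).
Qed.

Hypothesis charK : [pchar K] =i pred0.

(** By the Vandermonde determinant, [n] of these forms span all linear forms. *)
Lemma eventually_avoids J : is_ideal J -> ~ contains_powers J ->
  exists t0, forall t, (t0 <= t)%N -> ~ J (moment_form t).
Proof.
move=> iJ nJ; apply: contrapT => h; apply: nJ.
have [k|g hg hJ] := @frequently_subsequence (fun t => J (moment_form t)).
  apply: contrapT => h'; apply: h; exists k => t kt Jt; apply: h'.
  by exists t.
have g_mono : {homo g : i j / (i < j)%N} by apply: homo_ltn => //; apply: ltn_trans.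
pose a : 'rV[K]_n := \row_j (g j)%:R.
have dV : Vandermonde n a \in unitmx.
  rewrite unitmxE unitfE det_Vandermonde; apply/prodf_neq0 => i _.
  apply/prodf_neq0 => j lij; rewrite !mxE -natrB; last exact/ltnW/g_mono.
  by rewrite ((pcharf0P K).1 charK) -lt0n subn_gt0; apply: g_mono.
exists 1%N => k; rewrite expr1.
pose W := invmx (Vandermonde n a).
have orth (i : 'I_n) : \sum_j W j k * (g j)%:R ^+ i = (i == k)%:R.
  have := congr1 (fun M : 'M_n => M i k) (mulmxV dV); rewrite /= !mxE => <-.
  by apply: eq_bigr => j _; rewrite !mxE mulrC.
have -> : 'X_k = \sum_j (W j k) *: moment_form (g j).
  under eq_bigr => j _ do rewrite scaler_sumr.
  rewrite exchange_big /=.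
  under eq_bigr => i _ do under eq_bigr => j _ do rewrite scalerA.
  under eq_bigr => i _ do rewrite -scaler_suml orth.
  rewrite (bigD1 k) //= eqxx scale1r big1 ?addr0 // => i /negPf ->.
  by rewrite scale0r.
apply: (ideal_sum iJ) => j _; rewrite -mul_mpolyC; exact: idealMl.
Qed.

(** Noetherian induction: a reducible closed set is handled by its pieces; in
    an irreducible one, a form avoiding its generic point has no zeros, as
    there are no further points. *)
Lemma eventually_contains_powers J : homog_ideal J -> zero_dimensional J ->
  exists t0, forall t, (t0 <= t)%N ->
    contains_powers (ideal_add J (moment_form t)).
Proof.
move=> hJ; have [iJ _] := hJ.
move: J iJ hJ; apply: noetherian_ind => J iJ IH hJ dJ.
have [rJ|[N hN]|[a [b [e [e' [ha hb Jab nJa nJb]]]]]] := homog_ideal_cases hJ.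
- have [_ _ nJ] := rJ; have [t0 ht0] := eventually_avoids iJ nJ.
  exists t0 => t /ht0 nt; apply: contrapT => np.
  have [Q rQ sQ] := relevant_prime_exists
    (ideal_add_homog hJ (zhomog_moment_form t)) np.
  apply: nt; apply: (dJ J Q) => //; last exact/sQ/mem_ideal_add.
  exact: subset_trans (sub_ideal_add _) sQ.
- by exists 0%N => t _; exists N => i; apply: sub_ideal_add.
have step c e'' : zhomog e'' c -> ~ J c -> exists t0, forall t, (t0 <= t)%N ->
    contains_powers (ideal_add (ideal_add J c) (moment_form t)).
  move=> hc nJc; apply: IH.
  - exact: ideal_add_ideal.
  - exact: sub_ideal_add.
  - by exists c => //; apply: mem_ideal_add.
  - exact: ideal_add_homog hc.
  - move=> Q Q' rQ rQ' sQ; apply: dJ => //.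
    exact: subset_trans (sub_ideal_add c) sQ.
have [t1 h1] := step _ _ ha nJa; have [t2 h2] := step _ _ hb nJb.
exists (maxn t1 t2) => t; rewrite geq_max => /andP[/h1 {}h1 /h2 {}h2].
have comm c : contains_powers (ideal_add (ideal_add J c) (moment_form t)) ->
    contains_powers (ideal_add (ideal_add J (moment_form t)) c).
  move=> [N hN]; exists N => i; have [_ [q [[s [q' [hs ->]]] ->]]] := hN i.
  by exists (s + q * moment_form t), q'; rewrite addrAC; split=> //; exists s, q.
apply: contains_powers_mul (comm _ h1) (comm _ h2).
  exact: ideal_add_ideal.
exact: sub_ideal_add.
Qed.

End Homogeneous.

(** * Points of Proj of a quotient *)

Section Points.
Variables (K : fieldType) (n : nat) (I : idealr {mpoly K[n]}).
Local Notation P := {mpoly K[n]}.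
Local Notation IS := [set p : P | p \in I]%classic.

Lemma idealr_ideal : is_ideal IS.
Proof.
split=> [|x y|a x] /=; first exact: rpred0.
  exact: rpredD.
exact: idealMr.
Qed.

Lemma quo_piP p q : reflect (quo_pi I p = quo_pi I q) (p - q \in I).
Proof. by rewrite Quotient.idealrBE; apply: eqP. Qed.

Lemma quo_pi0P p : reflect (quo_pi I p = 0) (p \in I).
Proof. by rewrite -[p in p \in I]subr0 -(rmorph0 (quo_pi I)); apply: quo_piP. Qed.

Lemma quo_pi_surj (x : quo I) : exists p, x = quo_pi I p.
Proof. by exists (repr x); rewrite /quo_pi reprK. Qed.

Lemma mem_image (Q : set P) p : is_ideal Q -> (IS `<=` Q)%classic ->
  (quo_pi I @` Q)%classic (quo_pi I p) -> Q p.
Proof.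
move=> iQ sQ [q hq /quo_piP e]; rewrite -[p](subrK q); apply: (idealD iQ) => //.
by rewrite -opprB; apply: (idealN iQ); apply: sQ.
Qed.

Lemma image_ideal (Q : set P) : is_ideal Q -> is_ideal (quo_pi I @` Q)%classic.
Proof.
move=> iQ; split=> [|_ _ [p hp <-] [q hq <-]|a _ [p hp <-]].
- by exists 0; [apply: ideal0 | rewrite rmorph0].
- by exists (p + q); [apply: idealD | rewrite rmorphD].
- have [b ->] := quo_pi_surj a.
  by exists (b * p); [apply: idealMl | rewrite rmorphM].
Qed.

Lemma image_homogeneous (Q : set P) : homog_ideal Q ->
  is_homogeneous_ideal (@quo_gr K n I) (quo_pi I @` Q)%classic.
Proof.
move=> [iQ hQ]; split=> [|_ [p hp <-]]; first exact: image_ideal.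
exists [seq quo_pi I (zcomp (nat_of_ord d) p) | d : 'I_(msize p)]; split.
  move=> _ /mapP [d _ ->]; split; first by exists (zcomp d p) => //; apply: hQ.
  by exists d; exists (zcomp d p) => //; apply: (zcompP d p).
rewrite {1}(zcomp_sum (zcomp_large (p := p))) rmorph_sum big_map /=.
by rewrite enumT.
Qed.

Lemma image_point (Q : set P) : relevant_prime Q -> (IS `<=` Q)%classic ->
  proj_point (@quo_gr K n I) (@quo_irr K n I) (quo_pi I @` Q)%classic.
Proof.
move=> [hQ [iQ Q1 pQ] nQ] sQ; split; last 1 first.
- move=> h; apply: nQ; exists 1%N => i; rewrite expr1; apply: (mem_image iQ sQ).
  by apply: h; exists 'X_i => //; apply: sub_gen_smallest; exists i.
- split; first exact: image_ideal.
    by rewrite -(rmorph1 (quo_pi I)) => /(mem_image iQ sQ).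
  move=> x y; have [p ->] := quo_pi_surj x; have [q ->] := quo_pi_surj y.
  by rewrite -rmorphM => /(mem_image iQ sQ)/pQ[]; [left|right]; [exists p|exists q].
- exact: image_homogeneous.
Qed.

(** A strict inclusion of relevant primes would give a chain of two irreducible
    closed sets. *)
Lemma dim_Proj_zero_dimensional : dim_Proj_le I 0 -> zero_dimensional IS.
Proof.
move=> dim0 Q Q' rQ rQ' sQ sQQ'; apply: contrapT => nQ'.
have sQ' : (IS `<=` Q')%classic by apply: subset_trans sQQ'.
have [hQ [iQ _ _] _] := rQ; have [hQ' [iQ' _ _] _] := rQ'.
pose V (A : set P) : set (set (quo I)) :=
  [set p | proj_point (@quo_gr K n I) (@quo_irr K n I) p
           /\ (quo_pi I @` A `<=` p)%classic]%classic.
have V_irr A : relevant_prime A -> (IS `<=` A)%classic ->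
    proj_closed (@quo_gr K n I) (@quo_irr K n I) (V A) /\
    proj_irreducible (@quo_gr K n I) (@quo_irr K n I) (V A).
  move=> rA sA; have pA := image_point rA sA; have [hA _ _] := rA.
  split; first by exists (quo_pi I @` A)%classic => //; apply: image_homogeneous.
  split; first by exists (quo_pi I @` A)%classic; split.
  have sub Z : proj_closed (@quo_gr K n I) (@quo_irr K n I) Z ->
      Z (quo_pi I @` A)%classic -> (V A `<=` Z)%classic.
    move=> [J _ ->] [_ sJ] p [hp sp]; split=> //; exact: subset_trans sp.
  move=> Z1 Z2 c1 c2 sZ; have [|h|h] := sZ (quo_pi I @` A)%classic.
  - by split.
  - by left; apply: sub.
  - by right; apply: sub.
suff : (1 <= 0)%N by [].
apply: (dim0 1%N (fun i => if i is 0%N then V Q' else V Q)).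
  by case=> [|i] _; apply: V_irr.
case=> // _; split=> [p [hp sp]|].
  split=> //; apply: subset_trans sp => _ [q hq <-]; exists q => //.
  exact: sQQ'.
move=> /(_ (quo_pi I @` Q)%classic) [|_ h]; first by split=> //; apply: image_point.
apply: nQ' => q hq; apply: (mem_image iQ sQ); apply: h; by exists q.
Qed.

End Points.

(** * Linear projections in a graded piece *)

(** Take a subspace of largest dimension inside [U]. *)
Lemma subspace_vspace (K : fieldType) (V : vectType K) (U : set V) :
  U 0 -> (forall c u v, U u -> U v -> U (c *: u + v)) ->
  exists W : {vspace V}, forall v, v \in W <-> U v.
Proof.
move=> U0 UD; have UA u v : U u -> U v -> U (u + v).
  by move=> /(UD 1 u v); rewrite scale1r.
pose Q k := `[< exists W : {vspace V}, \dim W = k /\ forall v, v \in W -> U v >].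
have ex : exists k, Q k.
  exists 0%N; apply/asboolP; exists 0%VS; rewrite dimv0; split=> // v.
  by rewrite memv0 => /eqP ->.
have bd k : Q k -> (k <= \dim {:V})%N.
  by move=> /asboolP [W [<- _]]; apply/dimvS/subvf.
case: (ex_maxnP ex bd) => k /asboolP [W [dW sW]] mx.
exists W => v; split=> [/sW //|Uv]; apply: contrapT => /negP nv.
have : Q (\dim (W + <[v]>)).
  apply/asboolP; exists (W + <[v]>)%VS; split=> // _ /memv_addP [w hw [_ /vlineP [c ->] ->]].
  by rewrite addrC; apply: UD => //; apply: sW.
move/mx; rewrite leqNgt -dW ltn_neqAle; case/negP.
rewrite (dimv_leqif_eq (addvSl W _)).1 andbT (dimv_leqif_eq (addvSl W _)).2.
apply: contra nv => /eqP ->; apply: (subvP (addvSr W _)); exact: memv_line.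
Qed.

(** Functionals will be extended from the saturation, and elements separated
    from an ideal, by means of this projection onto the part of [U] of
    degree [e]. *)
Lemma graded_projection (K : fieldType) r (U : set {mpoly K[r.+1]}) e :
  U 0 -> (forall c u v, U u -> U v -> U (c *: u + v)) ->
  exists pr : {linear {mpoly K[r.+1]} -> {mpoly K[r.+1]}},
    [/\ forall p, U (pr p) /\ zhomog e (pr p),
        forall p, U p -> zhomog e p -> pr p = p
      & forall p, pr (zcomp e p) = pr p].
Proof.
move=> U0 UD; case: e => [d|d]; last first.
  exists \0%R; split=> [p|p Up /eqP ->|p] //=.
have [W hW] := @subspace_vspace K (dhomog r.+1 K d)
  [set v | U (v : {mpoly K[r.+1]})]%classic U0 (fun c u v => UD c _ _).
pose pr p : {mpoly K[r.+1]} := projv W (indhomog d (zcomp d p)).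
have indE p : p \is d.-homog -> (indhomog d p : {mpoly K[r.+1]}) = p.
  by move=> hp; rewrite /indhomog insubdK.
have pr_lin : linear pr.
  move=> c p q; rewrite /pr linearP /=.
  have -> : indhomog d (c *: zcomp d p + zcomp d q)
      = c *: indhomog d (zcomp d p) + indhomog d (zcomp d q).
    have hp := zcompP d p; have hq := zcompP d q.
    by apply: val_inj; rewrite /= !indE ?dhomogD ?dhomogZ.
  by rewrite linearP.
pose prl : {linear {mpoly K[r.+1]} -> {mpoly K[r.+1]}} :=
  HB.pack pr (GRing.isLinear.Build K _ _ _ pr pr_lin).
exists prl; split=> [p|p Up hp|p] /=.
- by split; [apply/hW/memv_proj | apply: dhomog_is_dhomog].
- rewrite /pr (zcomp_id (e := d) hp) projv_id ?indE //.
  by apply/hW; rewrite /= indE.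
- by rewrite /pr zcomp_zcomp eqxx.
Qed.

(** * The duality *)

Section Duality.
Variables (K : fieldType) (r : nat).
Hypothesis charK : [pchar K] =i pred0.
Local Notation n := r.+1.
Local Notation P := {mpoly K[n]}.
Local Notation B := {mpoly {mpoly K[n]}[n]}.
Local Notation "\m" := (@mirr K n).

(** ** Saturation *)

Lemma mirr_ideal : is_ideal \m. Proof. exact: ideal_gen_ideal. Qed.

Lemma moment_form_mirr t : \m (moment_form K n t).
Proof.
apply: (ideal_sum mirr_ideal) => i _; rewrite -mul_mpolyC.
apply: (idealMl mirr_ideal); apply: sub_gen_smallest; by exists i.
Qed.

Lemma pow_mem_ideal_pow h N : \m h -> ideal_pow \m N (h ^+ N).
Proof.
move=> hh; elim: N => // N IH; rewrite exprS.
by apply: sub_gen_smallest; exists h, (h ^+ N).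
Qed.

(** The multiples of an element of the [N]-th power of the irrelevant ideal have
    no components of degree below [N]. *)
Lemma ideal_pow_low N a : ideal_pow \m N a ->
  forall p e, (e < N)%N -> zcomp (Posz e) (a * p) = 0.
Proof.
pose low N : set P :=
  [set a | forall p e, (e < N)%N -> zcomp (Posz e) (a * p) = 0]%classic.
have low_ideal k : is_ideal (low k).
  split=> [p e _|x y hx hy p e lt|c x hx p e lt].
  - by rewrite mul0r zcomp0.
  - by rewrite mulrDl linearD /= hx // hy // addr0.
  - by rewrite [c * x]mulrC -mulrA hx.
suff sub : (ideal_pow \m N `<=` low N)%classic by apply: sub.
elim: N => // N IH; apply: smallest_sub; first exact: low_ideal.
move=> _ [x [y [hx /IH hy ->]]].
pose D : set P := [set x | low N.+1 (x * y)]%classic.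
suff : (\m `<=` D)%classic by apply.
apply: smallest_sub.
  split=> [|u v hu hv|c u hu]; rewrite /D /=.
  - by rewrite mul0r; apply: (ideal0 (low_ideal _)).
  - by rewrite mulrDl; apply: (idealD (low_ideal _)).
  - by rewrite -mulrA; apply: (idealMl (low_ideal _)).
move=> _ [i _ <-] p e lt; rewrite -mulrA (zcompM_homogl _ _ (zhomog_X K i)).
case: e lt => [|e] lt; first by rewrite mulr0.
by rewrite -[e.+1]addn1 PoszD addrK hy ?mulr0.
Qed.

Section Data.
Variables (I : idealr P) (d : 'I_n -> nat) (f : 'I_n -> P).
Hypothesis adm : admissible I d f.
Local Notation IS := [set p : P | p \in I]%classic.
Let iI : is_ideal IS := idealr_ideal I.

Lemma mem_f j : f j \in I.
Proof.
case: adm => _ eI _; have : ideal_gen (range f) (f j).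
  by apply: sub_gen_smallest; exists j.
by rewrite -eI.
Qed.

Lemma mem_combination p : p \in I -> exists c, p = \sum_j c j * f j.
Proof.
case: adm => _ eI _ hp; have {hp} : ideal_gen (range f) p by rewrite -eI.
pose D : set P := [set p | exists c : 'I_n -> P, p = \sum_j c j * f j]%classic.
move=> h; suff : D p by [].
move: p h; apply: smallest_sub => [|_ [j _ <-]].
  split=> [|_ _ [c ->] [c' ->]|a _ [c ->]].
  - by exists (fun=> 0); rewrite big1 // => j _; rewrite mul0r.
  - exists (fun j => c j + c' j); rewrite -big_split; apply: eq_bigr => j _.
    by rewrite mulrDl.
  - exists (fun j => a * c j); rewrite mulr_sumr; apply: eq_bigr => j _.
    by rewrite mulrA.
exists (fun k => (k == j)%:R); rewrite (bigD1 j) //= eqxx mul1r big1 ?addr0 //.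
by move=> k /negPf ->; rewrite mul0r.
Qed.

Lemma idealr_homog : homog_ideal IS.
Proof.
split=> // e p /mem_combination [c ->]; rewrite raddf_sum.
apply: (ideal_sum iI) => j _ /=; case: adm => hf _ _.
by rewrite (zcompM_homog _ _ (hf j : zhomog (d j)%:Z (f j))); apply/idealMr/mem_f.
Qed.

Definition kills (phi : {scalar P}) := forall p, p \in I -> phi p = 0.

Lemma bezoutian_contracts phi :
  kills phi -> forall j, contracts_into phi IS (inX (f j) - inY (f j)).
Proof.
move=> hphi j; apply: (idealB (contracts_into_ideal phi iI)).
  by apply: contracts_into_inX => // p; apply/hphi; rewrite mulrC; apply/idealMr/mem_f.
by apply: contracts_into_inY => //; apply: mem_f.
Qed.

Lemma slice_bezoutian_unique phi T T' :
  kills phi -> bezoutian f T -> bezoutian f T' ->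
  slice phi (\det T) - slice phi (\det T') \in I.
Proof.
move=> hphi hT hT'.
have := bezoutian_det_unique (contracts_into_ideal phi iI)
  (bezoutian_contracts hphi) hT hT'.
by move=> /(_ 1); rewrite mul1r raddfB.
Qed.

(** The two ways of multiplying by [a] agree on the Bezoutian, by Cramer's
    rule for [T]. *)
Lemma bezoutian_diagonal (J : set B) T a :
  is_ideal J -> (forall j, J (inX (f j) - inY (f j))) -> bezoutian f T ->
  J ((inX a - inY a) * \det T).
Proof.
move=> iJ hJ hT; have [c ->] := difference_quotient_ex a.
rewrite mulr_suml; apply: (ideal_sum iJ) => i _; rewrite -mulrA.
apply: (idealMl iJ).
have := congr1 (fun M : 'cV_n => M i 0) (mulmxA (\adj T) T (zvec K n)).
rewrite mul_adj_mx mul_scalar_mx hT /= [RHS]mxE [zvec _ _ _ _]mxE mulrC => <-.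
rewrite mxE; apply: (ideal_sum iJ) => j _; apply: (idealMl iJ).
by rewrite mxE.
Qed.

Lemma slice_bezoutian_mul phi T a : kills phi -> bezoutian f T ->
  slice phi (inX a * \det T) - a * slice phi (\det T) \in I.
Proof.
move=> hphi hT.
have := bezoutian_diagonal a (contracts_into_ideal phi iI)
  (bezoutian_contracts hphi) hT.
by move=> /(_ 1); rewrite mul1r mulrBl raddfB /= slice_mulY.
Qed.

Definition homog_matrix (T : 'M[B]_n) := forall j i, tdeg ((d j)%:Z - 1) (T j i).

Lemma bezoutian_ex : exists2 T, bezoutian f T & homog_matrix T.
Proof.
by case: adm => hf _ _; apply: (bezoutian_homog (e := fun j => (d j)%:Z)) hf.
Qed.

Lemma tdeg_bezoutian T : homog_matrix T -> tdeg (sigma d) (\det T).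
Proof.
move=> hT; have := tdeg_det hT; rewrite sumrB.
suff -> : \sum_(j < n) (d j)%:Z - \sum_(j < n) 1 = sigma d by [].
rewrite sumr_const card_ord /sigma mulrS opprD [- 1 - _]addrC addrA.
by rewrite natz (big_morph Posz PoszD (erefl _)).
Qed.

Lemma saturation_power x t : Isat I x ->
  exists N, forall M, (N <= M)%N -> x * moment_form K n t ^+ M \in I.
Proof.
move=> [N hN]; exists N => M NM; rewrite mulrC; apply: hN.
apply: (ideal_pow_le NM); exact: pow_mem_ideal_pow (moment_form_mirr t).
Qed.

Definition scalar_comp (phi : {scalar P}) (g : {linear P -> P}) : P -> K :=
  fun p => phi (g p).
Lemma scalar_comp_scalar phi g : scalar (scalar_comp phi g).
Proof. by move=> c p q; rewrite /scalar_comp linearP linearP. Qed.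
HB.instance Definition _ phi g :=
  GRing.isLinear.Build K P K _ (scalar_comp phi g) (scalar_comp_scalar phi g).

(** As [Proj (P / I)] has dimension at most 0, some linear form [l] has no zero on it.
    For large [M] this puts [x * l ^+ M] in [I], and large powers of the
    variables in [I + (l ^+ M)]; so there is a residue functional, contraction
    with which recovers [x] modulo [I + (l ^+ M)].  In degree [k] the multiples
    of [l ^+ M] vanish once [M > k]. *)
Lemma saturation_is_contraction x k T :
  zhomog k x -> Isat I x -> bezoutian f T ->
  exists phi : {scalar P}, [/\ kills phi,
    forall p, phi p = phi (zcomp (sigma d - k) p)
    & slice phi (\det T) - x \in I].
Proof.
move=> hx sx hT; case: k hx => [k|k] hx; last first.
  exists \0%R; split=> //; rewrite (eqP hx) subr0 slice0 //.
  exact: rpred0.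
have [_ _ dim0] := adm; have hI := idealr_homog.
have [t0 ht0] := eventually_contains_powers charK hI (dim_Proj_zero_dimensional dim0).
have [N0 hN0] := ht0 _ (leqnn t0); pose l := moment_form K n t0.
have [N1 hN1] := saturation_power t0 sx.
(* [M] exceeds both [N1], so that [x * H] lies in [I], and the degree [k]; [N] is
   positive, as the socle exponent [N.-1] requires. *)
pose M := (N1 + k.+1)%N; pose H := l ^+ M; pose N := (N0 * M).+1.
have powers i : ideal_add IS H ('X_i ^+ N).
  have iL := ideal_add_ideal H iI; rewrite /N exprSr; apply: (ideal_mulr iL).
  have [s [q [hs e]]] := hN0 i; rewrite exprM e -[_ ^+ M](subrK ((q * l) ^+ M)).
  exists ((s + q * l) ^+ M - (q * l) ^+ M), (q ^+ M); split; last by rewrite exprMn.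
  by apply: (ideal_subX iI); rewrite addrK.
have hb i : exists c : 'rV[P]_n * P, 'X_i ^+ N = \sum_j c.1 0 j * f j + c.2 * H.
  have [s [q [/mem_combination [c ->] ->]]] := powers i.
  by exists (\row_j c j, q); congr (_ + _); apply: eq_bigr => j _; rewrite mxE.
have [c hc] := choice hb.
have [u hu] := mem_combination (hN1 M (leq_addr _ _)).
have [T0 hT0 tT0] := bezoutian_ex.
have iL := ideal_add_ideal H iI.
have [||||phi [phif hphi]] := @residue_functional K n N isT f T0
    (\matrix_(i, j) (c i).1 0 j) (\col_i (c i).2) (\row_j u j) H x hT0 _ _
    (ideal_add IS H) iL.
- by move=> i; rewrite hc mxE; congr (_ + _); apply: eq_bigr => j _; rewrite mxE.
- by rewrite hu; apply: eq_bigr => j _; rewrite mxE.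
- by move=> j; apply/sub_ideal_add/mem_f.
- exact: mem_ideal_add.
have kphi : kills phi.
  by move=> p /mem_combination [a ->]; rewrite raddf_sum big1 // => j _; apply: phif.
exists (scalar_comp phi (zcomp (sigma d - k%:Z))).
have kphi' : kills (scalar_comp phi (zcomp (sigma d - k%:Z))).
  by move=> p /(hI.2 (sigma d - k%:Z)) /kphi.
split=> // [p|]; first by rewrite /= /scalar_comp /= zcomp_zcomp eqxx.
rewrite -[_ - x](subrKA (slice (scalar_comp phi (zcomp (sigma d - k%:Z))) (\det T0))).
rewrite rpredD ?slice_bezoutian_unique //.
rewrite (slice_zcomp (phi := phi) (k := k) _ (tdeg_bezoutian tT0)) // -(zcomp_id hx).
rewrite -linearB /=; have [s [q [hs ->]]] := hphi.
rewrite linearD /= (zcompM_homog (e := M%:Z)); last first.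
  by have := dhomogMn M (zhomog_moment_form K n t0); rewrite mul1n.
have -> : zcomp (k%:Z - M%:Z) q = 0.
  suff -> : k%:Z - M%:Z = Negz N1 by [].
  by rewrite NegzE /M addnC addSnnS PoszD opprD addrA subrr add0r.
by rewrite mul0r addr0; apply: hI.2.
Qed.

Lemma slice_scalarB (phi psi : {scalar P}) (F : B) :
  slice (phi \- psi) F = slice phi F - slice psi F.
Proof.
elim/tensor_ind: F => [|F G hF hG|p q]; first by rewrite !raddf0 addr0.
  rewrite raddfD [slice phi _]raddfD [slice psi _]raddfD /= hF hG.
  by rewrite opprD addrACA.
by rewrite !sliceXY scalerBl.
Qed.

(** By [saturation_is_contraction] for the transposed Bezoutian, [q] is its
    contraction with some [psi]; contracting with [phi] and with [psi] in
    either order gives [phi q = psi (slice phi (\det T))]. *)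
Lemma contraction_determines phi T q e : kills phi -> bezoutian f T ->
  slice phi (\det T) \in I -> zhomog e q -> Isat I q -> phi q = 0.
Proof.
move=> kphi hT h hq sq.
have [psi [kpsi _]] := saturation_is_contraction hq sq (bezoutian_swap hT).
rewrite det_map_mx => /kphi; rewrite raddfB /= slice_swap swapXYK kpsi // sub0r.
by move=> /eqP; rewrite oppr_eq0 => /eqP.
Qed.

(** High powers of the irrelevant ideal kill a contraction with a homogeneous
    functional: they can be moved to the side of the functional. *)
Lemma contraction_saturated phi T e : kills phi -> bezoutian f T ->
  homog_matrix T -> (forall p, phi p = phi (zcomp e p)) ->
  zhomog (sigma d - e) (slice phi (\det T)) /\ Isat I (slice phi (\det T)).
Proof.
move=> kphi hT tT hphi; split.
  rewrite (slice_zcomp (phi := phi) (k := sigma d - e) _ (tdeg_bezoutian tT)).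
    exact: zcompP.
  by move=> p; rewrite subKr.
exists (`|e|.+1)%N => a ha /=.
rewrite -[a * _](subKr (slice phi (inX a * \det T))).
rewrite rpredB ?slice_bezoutian_mul //.
rewrite (slice_mulX (psi := scalar_mul a phi)) // slice0 ?rpred0 // => p.
rewrite /= /scalar_mul hphi; case: e hphi ha => [e|e] hphi ha; last first.
  by rewrite raddf0.
by rewrite (ideal_pow_low ha) ?raddf0.
Qed.

End Data.
End Duality.

(** ** The pairing *)

Section Pairing.
Variables (K : fieldType) (r : nat).
Hypothesis charK : [pchar K] =i pred0.
Local Notation n := r.+1.
Local Notation P := {mpoly K[n]}.
Local Notation B := {mpoly {mpoly K[n]}[n]}.

(** If [x] is the contraction of the Bezoutian with [phi], then [x] is sent to
    the restriction of [phi] to the saturation: this is the inverse of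
    contraction with the Bezoutian, made independent of choices by
    [dualityE]. *)
Definition duality_spec (I : idealr P) (d : 'I_n -> nat) (f : 'I_n -> P) (k : int)
    (x : H0m I k) (L : gr_dual (gr_shift (sigma d) (H0m I)) k) : Prop :=
  exists phi T, [/\ kills I phi, bezoutian f T,
    val x = quo_pi I (slice phi (\det T))
  & forall (y : H0m I (sigma d - k)) q, val y = quo_pi I q -> L y = phi q].

Definition duality (I : idealr P) (d : 'I_n -> nat) (f : 'I_n -> P) (k : int)
    (x : H0m I k) : gr_dual (gr_shift (sigma d) (H0m I)) k :=
  if pselect (exists L, duality_spec f x L) is left h then sval (cid h) else 0.

Section Functionals.
Variable I : idealr P.

Lemma quo_pi_lin (c : K) p q :
  quo_pi I (c *: p + q) = c *: quo_pi I p + quo_pi I q.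
Proof. by rewrite rmorphD -mul_mpolyC rmorphM. Qed.

Lemma kills_eq phi p q : kills I phi -> quo_pi I p = quo_pi I q -> phi p = phi q.
Proof.
move=> h /quo_piP /h; rewrite raddfB => /eqP; rewrite subr_eq0 => /eqP.
by [].
Qed.

Lemma H0m_rep e (y : H0m_piece I e) :
  exists p, [/\ zhomog e p, Isat I p & val y = quo_pi I p].
Proof. by case: y => y /= /asboolP. Qed.

Lemma H0m_mem e p : zhomog e p -> Isat I p ->
  exists y : H0m_piece I e, val y = quo_pi I p.
Proof.
move=> hp sp; have h : quo_pi I p \in @H0m_pred K n I e by apply/asboolP; exists p.
by exists (H0mPiece h).
Qed.

Lemma dual_of_functional phi e : kills I phi ->
  exists L : dual (H0m_piece I e), forall y q, val y = quo_pi I q -> L y = phi q.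
Proof.
move=> h; pose L (y : H0m_piece I e) : K^o := phi (repr (val y)).
have rE (y : quo I) : quo_pi I (repr y) = y by rewrite /quo_pi reprK.
have lin : L \in @linear_pred K (H0m_piece I e).
  apply/asboolP => c y z.
  have -> : c *: L y + L z = phi (c *: repr (val y) + repr (val z)).
    by rewrite linearP.
  by apply: kills_eq; rewrite // quo_pi_lin !rE.
exists (Dual lin) => y q hy /=.
by apply: kills_eq; rewrite // rE.
Qed.

Lemma dual0 (V : lmodType K) (L : dual V) : L 0 = 0.
Proof.
by have := dual_linear L (-1) 0 0; rewrite scaler0 addr0 scaleN1r addNr.
Qed.

Hypothesis hI : homog_ideal [set p : P | p \in I]%classic.

(** A functional on a piece of the saturation extends by zero along a projection
    onto that piece. *)
Lemma functional_of_dual e (L : dual (H0m_piece I e)) :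
  exists phi, [/\ kills I phi, forall p, phi p = phi (zcomp e p)
    & forall y q, val y = quo_pi I q -> L y = phi q].
Proof.
have IsatZ c u v : Isat I u -> Isat I v -> Isat I (c *: u + v).
  by move=> hu hv; apply: IsatD => //; rewrite -mul_mpolyC; apply: IsatM.
have [pr [prU prE prz]] := @graded_projection K r (Isat I) e (Isat0 I) IsatZ.
pose l p : K := if pselect (quo_pi I p \in @H0m_pred K n I e) is left h
  then L (H0mPiece h) else 0.
have lE (y : H0m_piece I e) p : val y = quo_pi I p -> l p = L y.
  move=> hy; rewrite /l; case: pselect => [h|[]]; last by rewrite -hy; case: (y).
  by congr (L _); apply: val_inj.
have prH p : exists y : H0m_piece I e, val y = quo_pi I (pr p).
  by have [h1 h2] := prU p; apply: H0m_mem.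
have lin : scalar (fun p => l (pr p)).
  move=> c p q; have [y hy] := prH p; have [z hz] := prH q.
  rewrite (lE _ _ hy) (lE _ _ hz) (lE (c *: y + z)); first exact: dual_linear.
  by rewrite linearP quo_pi_lin /= hy hz.
pose phi : {scalar P} := HB.pack (fun p => l (pr p))
  (GRing.isLinear.Build K _ _ _ (fun p => l (pr p)) lin).
have kphi : kills I phi.
  move=> p hp; rewrite /= -prz prE; last exact: zcompP.
    rewrite (lE 0) ?dual0 //; apply/esym/quo_pi0P; exact: hI.2.
  exists 0%N => a _ /=; apply: idealMr; exact: hI.2.
exists phi; split=> // [p|y q hy]; first by rewrite /= prz.
have [p [hp sp e1]] := H0m_rep y.
rewrite (@kills_eq phi q p) // -?hy //= prE //.
by rewrite (lE y).
Qed.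

Lemma separating_functional k p : zhomog k p -> p \notin I ->
  exists psi, [/\ kills I psi, forall q, psi q = psi (zcomp k q) & psi p != 0].
Proof.
move=> hp nI; have [iI hI'] := hI.
have [||pr [prU prE prz]] := @graded_projection K r [set p : P | p \in I]%classic k.
- exact: rpred0.
- by move=> c u v hu hv; apply: (idealD iI) => //; rewrite -mul_mpolyC; apply: idealMr.
have w0 : p - pr p != 0.
  apply: contra nI; rewrite subr_eq0 => /eqP ->; by have [] := prU p.
pose m := mlead (p - pr p).
have lin : scalar (fun q => (zcomp k q - pr q)@_m).
  move=> c u v; rewrite [zcomp k _]linearP [pr _]linearP /=.
  rewrite !(mcoeffB, mcoeffD, mcoeffZ); ring.
pose psi : {scalar P} := HB.pack (fun q => (zcomp k q - pr q)@_m)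
  (GRing.isLinear.Build K _ _ _ (fun q => (zcomp k q - pr q)@_m) lin).
exists psi; split=> [q hq|q|] /=.
- by rewrite -(prz q) prE ?subrr ?mcoeff0 //; [apply: hI' | apply: zcompP].
- by rewrite zcomp_zcomp eqxx prz.
- by rewrite (zcomp_id hp) mleadc_eq0.
Qed.

End Functionals.

Section Isomorphism.
Variables (I : idealr P) (d : 'I_n -> nat) (f : 'I_n -> P).
Hypothesis adm : admissible I d f.
Let hI := idealr_homog adm.

Lemma contraction_ex k (x : H0m I k) T : bezoutian f T ->
  exists2 phi, kills I phi & val x = quo_pi I (slice phi (\det T)).
Proof.
move=> hT; have [p [hp sp ex]] := H0m_rep x.
have [phi [kphi _ h]] := saturation_is_contraction charK adm hp sp hT.
by exists phi => //; rewrite ex; apply/esym/quo_piP.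
Qed.

Lemma dualityP k (x : H0m I k) : duality_spec f x (duality d f x).
Proof.
rewrite /duality; case: pselect => [h|[]]; first by case: (cid h).
have [T hT _] := bezoutian_ex adm; have [phi kphi ex] := contraction_ex x hT.
have [L hL] := dual_of_functional (sigma d - k) kphi.
by exists L, phi, T.
Qed.

(** Two functionals with the same contraction differ by one whose contraction
    vanishes, and that one kills the saturation. *)
Lemma dualityE k (x : H0m I k) (y : H0m I (sigma d - k)) phi T q :
  kills I phi -> bezoutian f T -> val x = quo_pi I (slice phi (\det T)) ->
  val y = quo_pi I q -> duality d f x y = phi q.
Proof.
move=> kphi hT ex ey.
have [phi0 [T0 [kphi0 hT0 ex0 /(_ y q ey) ->]]] := dualityP x.
have [p [hp sp eyp]] := H0m_rep y.
have eqp : quo_pi I q = quo_pi I p by rewrite -ey.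
rewrite (kills_eq kphi0 eqp) (kills_eq kphi eqp); apply/eqP.
rewrite -subr_eq0; apply/eqP.
rewrite -[LHS]/((phi0 \- phi) p).
apply: (contraction_determines charK adm _ hT _ hp sp).
  by move=> s hs; rewrite /= kphi0 ?kphi ?subrr.
rewrite slice_scalarB -(subrKA (slice phi0 (\det T0))) rpredD //.
  exact: (slice_bezoutian_unique adm).
by apply/quo_piP; exact: etrans (esym ex0) ex.
Qed.

Lemma slice_lin (phi psi chi : {scalar P}) c (F : B) :
  (forall p, chi p = c * phi p + psi p) ->
  slice chi F = c *: slice phi F + slice psi F.
Proof.
move=> h; elim/tensor_ind: F => [|F G hF hG|p q].
- by rewrite !raddf0 addr0.
- rewrite raddfD [slice phi _]raddfD [slice psi _]raddfD /= hF hG.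
  by rewrite scalerDr addrACA.
- by rewrite !sliceXY h scalerDl scalerA.
Qed.

Lemma duality_linear k : linear (@duality I d f k).
Proof.
move=> c x x'; apply: dualP => y.
have [T hT _] := bezoutian_ex adm.
have [phi kphi ex] := contraction_ex x hT; have [psi kpsi ex'] := contraction_ex x' hT.
have [q ey] := quo_pi_surj (val y).
have lin : scalar (fun p => c * phi p + psi p).
  move=> b u v; rewrite !linearP /= !mulrDr addrACA; congr (_ + _ + _).
  by rewrite mulrCA.
pose chi : {scalar P} := HB.pack (fun p => c * phi p + psi p)
  (GRing.isLinear.Build K _ _ _ (fun p => c * phi p + psi p) lin).
have -> : duality d f (c *: x + x') y = chi q.
  apply: dualityE hT _ ey => [p hp|]; first by rewrite /= kphi // kpsi // mulr0 addr0.
  rewrite (slice_lin (phi := phi) (psi := psi) (c := c)) // quo_pi_lin -ex -ex'.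
  by [].
rewrite -[RHS]/(c * duality d f x y + duality d f x' y).
by rewrite (dualityE kphi hT ex ey) (dualityE kpsi hT ex' ey).
Qed.

(** Separate a nonzero [x] from 0 by a functional [psi].  The contraction [y] of
    the transposed Bezoutian with [psi] pairs with [x] to [psi x]. *)
Lemma duality_inj k (x : H0m I k) : (forall y, duality d f x y = 0) -> x = 0.
Proof.
move=> h; have [T hT tT] := bezoutian_ex adm.
have [phi kphi ex] := contraction_ex x hT; have [p [hp sp exp]] := H0m_rep x.
apply: val_inj; rewrite exp; apply/quo_pi0P; apply: contrapT => /negP nI.
have [psi [kpsi psik psip]] := separating_functional hI hp nI.
have tS : homog_matrix d (map_mx (@swapXY K n) T).
  by move=> j i; rewrite mxE; apply: tdeg_swap.
have [hy sy] := contraction_saturated adm kpsi (bezoutian_swap hT) tS psik.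
have [y ey] := H0m_mem hy sy.
have := dualityE kphi hT ex ey; rewrite (h y) det_map_mx slice_swap swapXYK => /esym e0.
case/eqP: psip; apply: etrans e0; apply: (kills_eq kpsi).
exact: etrans (esym exp) ex.
Qed.

(** Extend the functional and contract: the result lies in the saturation and in
    the right degree. *)
Lemma duality_surj k (L : gr_dual (gr_shift (sigma d) (H0m I)) k) :
  exists x : H0m I k, duality d f x = L.
Proof.
have [T hT tT] := bezoutian_ex adm.
have [phi [kphi phik hL]] := functional_of_dual hI (L : dual (H0m_piece I (sigma d - k))).
have [hx sx] := contraction_saturated adm kphi hT tT phik.
rewrite subKr in hx.
have [x ex] := H0m_mem hx sx; exists x; apply: dualP => y.
have [q ey] := quo_pi_surj (val y).
by rewrite (dualityE kphi hT ex ey) -(hL y q ey).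
Qed.

Lemma duality_bij k : bijective (@duality I d f k).
Proof.
have [g hg] := choice (@duality_surj k).
have inj x x' : duality d f x = duality d f x' -> x = x' :> H0m I k.
  move=> e; apply/eqP; rewrite -subr_eq0; apply/eqP/duality_inj => y.
  have -> : x - x' = (-1) *: x' + x by rewrite scaleN1r addrC.
  rewrite duality_linear e scaleN1r addNr.
  by [].
by exists g => // x; apply: inj; rewrite hg.
Qed.

(** Multiplying by [a] in the first or in the second set of variables makes no
    difference to the contraction, so [a * x] is contracted from
    [phi] composed with [a]. *)
Lemma duality_act k l p (x : H0m I k) :
  duality d f (@gact K n (H0m I) k l p x)
  = @gact K n (gr_dual (gr_shift (sigma d) (H0m I))) k l p (duality d f x).
Proof.
apply: dualP => y; have [q ey] := quo_pi_surj (val y).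
have [T hT _] := bezoutian_ex adm; have [phi kphi ex] := contraction_ex x hT.
pose a := zcomp (l - k) p.
have ka : kills I (scalar_mul a phi).
  by move=> s hs; apply: kphi; apply: idealMr.
have -> : duality d f (@gact K n (H0m I) k l p x) y = phi (a * q).
  rewrite (dualityE (phi := scalar_mul a phi) ka hT _ ey) //=.
  rewrite ex -rmorphM; apply/esym/quo_piP.
  by rewrite -(slice_mulX (phi := phi) (q := a)) // (slice_bezoutian_mul adm).
rewrite /= (dualityE kphi hT ex (q := a * q)) //=.
rewrite ey -rmorphM; congr (quo_pi I (zcomp _ _ * _)).
by rewrite opprD addrACA subrr add0r opprK addrC.
Qed.

End Isomorphism.
End Pairing.

(** ** Naturality *)

Section Naturality.
Variables (K : fieldType) (r : nat).
Local Notation n := r.+1.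
Local Notation P := {mpoly K[n]}.
Local Notation B := {mpoly {mpoly K[n]}[n]}.
Implicit Types (g h : 'M[K]_n).

Lemma rmorph_mpoly_ext (C : comNzRingType) (u v : {rmorphism P -> C}) :
  (forall c, u c%:MP = v c%:MP) -> (forall i, u 'X_i = v 'X_i) -> u =1 v.
Proof.
move=> hC hX; elim/mpolyind => [|c m p _ _ IH]; first by rewrite !rmorph0.
rewrite !rmorphD -mul_mpolyC !rmorphM IH hC; congr (_ * _ + _).
rewrite mpolyXE_id !rmorph_prod; apply: eq_bigr => i _.
by rewrite !rmorphXn hX.
Qed.

Lemma linsub_linear g : linear (linsub g).
Proof. by move=> c p q; rewrite /linsub linearP. Qed.
Lemma linsub_monoid g : monoid_morphism (linsub g).
Proof. by rewrite /linsub; split; [apply: rmorph1 | apply: rmorphM]. Qed.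
HB.instance Definition _ g :=
  GRing.isLinear.Build K P P _ (linsub g) (linsub_linear g).
HB.instance Definition _ g :=
  GRing.isMonoidMorphism.Build P P (linsub g) (linsub_monoid g).

Lemma linsubC g c : linsub g c%:MP = c%:MP.
Proof. exact: comp_mpolyC. Qed.

Lemma linsubX g i : linsub g 'X_i = \sum_j g i j *: 'X_j.
Proof. by rewrite /linsub comp_mpolyXU -tnth_nth tnth_mktuple. Qed.

Lemma linsub1 (p : P) : linsub (1%:M : 'M[K]_n) p = p.
Proof.
apply: (@rmorph_mpoly_ext _ (linsub (1%:M : 'M[K]_n)) idfun) => [c|i]; first exact: linsubC.
rewrite /= linsubX (bigD1 i) //= big1 ?addr0 => [|j ne]; first by rewrite mxE eqxx scale1r.
by rewrite mxE eq_sym (negPf ne) scale0r.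
Qed.

Lemma linsubM g h p : linsub h (linsub g p) = linsub (g *m h) p.
Proof.
apply: (@rmorph_mpoly_ext _ (linsub h \o linsub g) (linsub (g *m h))) => [c|i].
  by rewrite /= !linsubC.
rewrite /= !linsubX linear_sum /=.
under eq_bigr => j _ do rewrite linearZ /= linsubX scaler_sumr.
rewrite exchange_big; apply: eq_bigr => k _ /=.
rewrite mxE scaler_suml; apply: eq_bigr => j _.
by rewrite scalerA.
Qed.

Lemma linsubK g : g \in unitmx -> cancel (linsub g) (linsub (invmx g)).
Proof. by move=> hg p; rewrite linsubM mulmxV ?linsub1. Qed.

Definition linsub2 g : B -> B := locked_with tensor_key
  (mmap (inX (n := n) \o linsub g) (fun i => inY (linsub g 'X_i))).

Lemma linsub2_zmod g : zmod_morphism (linsub2 g).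
Proof. by rewrite /linsub2 unlock; apply: rmorphB. Qed.
Lemma linsub2_monoid g : monoid_morphism (linsub2 g).
Proof. by rewrite /linsub2 unlock; split; [apply: rmorph1 | apply: rmorphM]. Qed.
HB.instance Definition _ g :=
  GRing.isZmodMorphism.Build B B (linsub2 g) (linsub2_zmod g).
HB.instance Definition _ g :=
  GRing.isMonoidMorphism.Build B B (linsub2 g) (linsub2_monoid g).

Lemma linsub2X g p : linsub2 g (inX p) = inX (linsub g p).
Proof. by rewrite /linsub2 unlock [inX p]inXE mmapC. Qed.

Lemma linsub2Y g p : linsub2 g (inY p) = inY (linsub g p).
Proof.
apply: (@rmorph_mpoly_ext _ (linsub2 g \o inY (n := n)) (inY (n := n) \o linsub g)).
  by move=> c; rewrite /= -inXY_C linsub2X linsubC inXY_C.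
by move=> i; rewrite /= inY_X /linsub2 unlock mmapX mmap1U.
Qed.

Lemma slice_linsub (phi psi : {scalar P}) g F :
  (forall p, psi (linsub g p) = phi p) ->
  slice psi (linsub2 g F) = linsub g (slice phi F).
Proof.
move=> h; elim/tensor_ind: F => [|F G hF hG|p q]; first by rewrite !raddf0.
  by rewrite !raddfD /= hF hG.
by rewrite rmorphM /= linsub2X linsub2Y !sliceXY h linearZ.
Qed.

Definition const2 (c : K) : B := inX c%:MP.
Lemma const2_zmod : zmod_morphism const2.
Proof. by move=> a b; rewrite /const2 !rmorphB. Qed.
Lemma const2_monoid : monoid_morphism const2.
Proof.
by split=> [|a b]; rewrite /const2 ?mpolyC1 ?rmorph1 // mpolyCM rmorphM.
Qed.
HB.instance Definition _ := GRing.isZmodMorphism.Build K B const2 const2_zmod.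
HB.instance Definition _ := GRing.isMonoidMorphism.Build K B const2 const2_monoid.

Lemma linsub2_zdiff g i :
  linsub2 g (zdiff K i) = \sum_j const2 (g i j) * zdiff K j.
Proof.
rewrite /zdiff rmorphB /= linsub2X linsub2Y linsubX !rmorph_sum -sumrB.
apply: eq_bigr => j _; rewrite -mul_mpolyC !rmorphM /= -inXY_C.
by rewrite -mulrBr.
Qed.

(** The differences of the variables transform by [g], so the Bezoutian acquires
    the factor [\det g]. *)
Lemma bezoutian_linsub g f T : bezoutian f T ->
  bezoutian (fun i => linsub g (f i)) (map_mx (linsub2 g) T *m map_mx const2 g).
Proof.
move=> /bezoutianP hT; apply/bezoutianP => j.
have := congr1 (linsub2 g) (hT j); rewrite rmorphB /= linsub2X linsub2Y => <-.
rewrite rmorph_sum /=.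
under [RHS]eq_bigr => k _ do rewrite rmorphM /= linsub2_zdiff mulr_sumr.
rewrite exchange_big; apply: eq_bigr => k _ /=.
rewrite mxE mulr_suml; apply: eq_bigr => i _.
by rewrite !mxE mulrA.
Qed.

(** Multiplying [f] by a matrix [A] multiplies the Bezoutian by [\det A]: the
    variation of [A] itself only contributes multiples of [f] in the second
    set of variables. *)
Lemma bezoutian_mulmx (J : set B) (A : 'M[P]_n) f f' T : is_ideal J ->
  (forall j, f' j = \sum_i A j i * f i) -> (forall i, J (inY (f i))) ->
  bezoutian f T ->
  exists2 T', bezoutian f' T' & J (\det T' - inX (\det A) * \det T).
Proof.
move=> iJ hA hJ /bezoutianP hT.
have [c hc] := choice (fun ji : 'I_n * 'I_n => difference_quotient_ex (A ji.1 ji.2)).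
pose T' := \matrix_(j, k) (\sum_i inX (A j i) * T i k + \sum_i c (j, i) k * inY (f i)).
exists T'.
  apply/bezoutianP => j; rewrite hA !rmorph_sum -sumrB.
  transitivity (\sum_i \sum_k (inX (A j i) * (T i k * zdiff K k)
                               + (c (j, i) k * zdiff K k) * inY (f i))).
    rewrite exchange_big; apply: eq_bigr => k _ /=; rewrite mxE mulrDl !mulr_suml.
    rewrite -big_split; apply: eq_bigr => i _ /=; rewrite mulrA; congr (_ + _).
    exact: mulrAC.
  apply: eq_bigr => i _; rewrite big_split -mulr_sumr -mulr_suml /= hT -(hc (j, i)) /=.
  by rewrite !rmorphM mulrBr mulrBl addrA subrK.
rewrite -(det_map_mx (@inX K n)) -det_mulmx; apply: (det_congr iJ) => j k.
rewrite !mxE addrAC (_ : _ - _ = 0) ?add0r.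
  by apply: (ideal_sum iJ) => i _; apply: (idealMl iJ).
apply/eqP; rewrite subr_eq0; apply/eqP/eq_bigr => i _.
by rewrite mxE.
Qed.

(** Invert [A] by its adjugate. *)
Lemma generators_transform (A : 'M[P]_n) a (J : set P) (f f' : 'I_n -> P) :
  is_ideal J -> \det A = a%:MP -> a != 0 ->
  (forall j, f' j = \sum_i A j i * f i) -> (forall j, J (f' j)) ->
  forall i, J (f i).
Proof.
move=> iJ dA a0 hA hJ i.
have e : a%:MP * f i = \sum_j (\adj A) i j * f' j.
  have := congr1 (fun M : 'cV_n => M i 0) (mulmxA (\adj A) A (\col_i f i)).
  rewrite mul_adj_mx mul_scalar_mx dA /= [RHS]mxE [X in _ = _ * X]mxE => <-.
  rewrite mxE; apply: eq_bigr => j _; rewrite [(A *m _) j 0]mxE hA.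
  by congr (_ * _); apply: eq_bigr => k _; rewrite mxE.
have -> : f i = (a^-1)%:MP * (a%:MP * f i).
  by rewrite mulrA -mpolyCM mulVf // mpolyC1 mul1r.
apply: (idealMl iJ); rewrite e; apply: (ideal_sum iJ) => j _.
exact: (idealMl iJ).
Qed.

Hypothesis charK : [pchar K] =i pred0.

(** The Bezoutian of [f'] is [a * \det g] times the transform of that of [f], so
    the functional representing [x'] is the transform of [phi] divided by this
    constant. *)
Lemma duality_natural :
  natural_in_data (fun I d f k => @duality K r I d f k).
Proof.
move=> I d f I' d' f' g A a adm adm' hg _ dA a0 hA k p q x y x' y' ex ex' ey ey'.
have [T hT _] := bezoutian_ex adm; have [phi kphi exT] := contraction_ex charK adm x hT.
have dg0 : \det g != 0 by rewrite -unitfE -unitmxE.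
pose c := (a * \det g)^-1.
have c0 : a * \det g != 0 by rewrite mulf_neq0.
pose fg i := linsub g (f i).
have I'f i : fg i \in I'.
  apply: (generators_transform (idealr_ideal I') dA a0 hA) => j.
  exact: (mem_f adm').
have gI s : s \in I -> linsub g s \in I'.
  move=> /(mem_combination adm) [b ->]; rewrite rmorph_sum rpred_sum // => j _.
  by rewrite rmorphM /=; apply/idealMr/I'f.
have gI' s : s \in I' -> linsub (invmx g) s \in I.
  move=> /(mem_combination adm') [b ->]; rewrite rmorph_sum rpred_sum // => j _.
  rewrite rmorphM /=; apply: idealMr; rewrite hA rmorph_sum rpred_sum // => i _.
  by rewrite rmorphM /=; apply: idealMr; rewrite linsubK // (mem_f adm).
have lin : scalar (fun s => c * phi (linsub (invmx g) s)).
  move=> b u v; rewrite [linsub _ _]linearP linearP mulrDr; congr (_ + _).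
  by rewrite mulrCA.
pose psi : {scalar P} := HB.pack (fun s => c * phi (linsub (invmx g) s))
  (GRing.isLinear.Build K _ _ _ (fun s => c * phi (linsub (invmx g) s)) lin).
have kpsi : kills I' psi by move=> s /gI' /kphi /= ->; rewrite mulr0.
have [T' hT' dT'] := bezoutian_mulmx
  (contracts_into_ideal psi (idealr_ideal I')) hA
  (fun i => contracts_into_inY psi (idealr_ideal I') (I'f i))
  (bezoutian_linsub g hT).
have e' : slice psi (\det T') - linsub g (slice phi (\det T)) \in I'.
  have := dT' 1; rewrite mul1r raddfB /=.
  suff -> : slice psi (inX (\det A) * \det (map_mx (linsub2 g) T *m map_mx const2 g))
      = linsub g (slice phi (\det T)) by [].
  rewrite det_mulmx !det_map_mx /= [linsub2 _ _ * _]mulrC mulrA dA /const2.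
  rewrite -rmorphM -mpolyCM (slice_mulX (psi := scalar_mul (a * \det g)%:MP psi)) //.
  apply: slice_linsub => s; rewrite /= /scalar_mul mul_mpolyC /= linearZ /=.
  by rewrite linearZ /= linsubK // /c mulKf.
rewrite (dualityE charK adm kphi hT exT ey).
rewrite (dualityE charK adm' kpsi hT' _ ey') /=.
  by rewrite linsubK // /c mulVKf.
rewrite ex'; apply/quo_piP; rewrite -opprB rpredN.
rewrite -[_ - _](subrKA (linsub g (slice phi (\det T)))) rpredD //.
rewrite -rmorphB; apply: gI; apply/quo_piP.
exact: etrans (esym exT) ex.
Qed.

End Naturality.

Unset Implicit Arguments.

Theorem theorem3p2 (R : realType) (r : nat) (hr : (2 <= r)%N) :
  exists Phi : forall (I : idealr {mpoly R[i][r.+1]}) (d : 'I_r.+1 -> nat)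
                 (f : 'I_r.+1 -> {mpoly R[i][r.+1]}) (k : int),
                 H0m I k -> gr_dual (gr_shift (sigma d) (H0m I)) k,
    natural_in_data Phi /\
    forall (I : idealr {mpoly R[i][r.+1]}) (d : 'I_r.+1 -> nat)
      (f : 'I_r.+1 -> {mpoly R[i][r.+1]}),
      admissible I d f ->
      is_gr_iso (Phi I d f) /\
      forall k : int, 0 <= k <= sigma d ->
        is_linear_iso (Phi I d f k : H0m I k -> dual (H0m I (sigma d - k))).
Proof.
have charC : [pchar R[i]] =i pred0 by apply: pchar_num.
exists (fun I d f k => @duality _ r I d f k); split; first exact: duality_natural.
move=> I d f adm.
have iso k : is_linear_iso (@duality _ r I d f k).
  by split; [apply: duality_linear | apply: duality_bij].
split=> [|k _]; last exact: iso.
by split=> // k l p x; apply: duality_act.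
Qed.
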